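(* Let $(\Omega,\mathcal{F},P)$ be a probability space and let $(E,\|\cdot\|)$ be a random normed module over $\mathbb{C}$ with base $(\Omega,\mathcal{F},P)$ such that $E$ has the countable concatenation property. Let $n\geq 1$, $f_{1},\dots,f_{n}\in E^{*}$, $\xi_{1},\dots,\xi_{n}\in L^{0}(\mathcal{F},\mathbb{C})$ and $\beta\in L^{0}_{+}$. Then the following two statements are equivalent: (a) for every $\varepsilon\in L^{0}_{++}$ there exists $x_{\varepsilon}\in E$ such that (1) $f_{i}(x_{\varepsilon})=\xi_{i}$ for $i=1,2,\dots,n$, and (2) $\|x_{\varepsilon}\|\leqslant\beta+\varepsilon$; (b) for all $\lambda_{1},\dots,\lambda_{n}\in L^{0}(\mathcal{F},\mathbb{C})$, $$\Big|\sum_{k=1}^{n}\lambda_{k}\xi_{k}\Big|\leqslant\beta\,\Big\|\sum_{k=1}^{n}\lambda_{k}f_{k}\Big\|^{*}.$$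
   Context: $L^{0}(\mathcal{F},K)$ ($K=\mathbb{R}$ or $\mathbb{C}$) is the algebra of a.s.-equivalence classes of $K$-valued $\mathcal{F}$-measurable functions on $\Omega$. $L^0(\mathcal{F},\mathbb{R})$ is ordered by $\xi\leqslant\eta$ iff $\xi\leqslant\eta$ a.s.; suprema $\vee$ are taken in this (Dedekind complete) order. $L^{0}_{+}=\{\xi\in L^{0}(\mathcal{F},\mathbb{R}):\xi\geqslant 0\}$, and $L^{0}_{++}=\{\xi\in L^0(\mathcal{F},\mathbb{R}):\xi>0 \text{ a.s. on }\Omega\}$. $\tilde I_A$ is the class of the indicator function of $A\in\mathcal{F}$. Random normed (RN) module over $K$ with base $(\Omega,\mathcal{F},P)$: a left module $E$ over the algebra $L^{0}(\mathcal{F},K)$ with a map $\|\cdot\|:E\to L^{0}_{+}$ such that $\|x\|=0$ iff $x=0$; $\|\xi x\|=|\xi|\,\|x\|$ for $\xi\in L^{0}(\mathcal{F},K)$, $x\in E$; and $\|x+y\|\leqslant\|x\|+\|y\|$. Countable concatenation property of $E$: for every sequence $(x_n)_{n\geq 1}$ in $E$ and every countable partition $(A_n)_{n\geq 1}$ of $\Omega$ into sets of $\mathcal{F}$ there is $x\in E$ with $\tilde I_{A_n}x=\tilde I_{A_n}x_n$ for all $n$. Random conjugate space $E^{*}$: all linear operators $f:E\to L^{0}(\mathcal{F},K)$ for which there is $\xi\in L^{0}_{+}$ with $|f(x)|\leqslant\xi\|x\|$ for all $x\in E$; it is an RN module under $(\xi\cdot f)(x)=\xi f(x)$ and $\|f\|^{*}=\vee\{|f(y)|: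 y\in E,\ \|y\|\leqslant 1\}$. *)

(* Defs.v *)
From HB Require Import structures.
From mathcomp Require Import all_boot all_order all_algebra.
From mathcomp Require Import complex.
From mathcomp Require Import all_classical all_reals all_analysis.
From mathcomp Require Import measurable_realfun.

Set Implicit Arguments.
Unset Strict Implicit.
Unset Printing Implicit Defensive.
Import Order.TTheory GRing.Theory Num.Theory.
Import ComplexField.Normc.

Local Open Scope classical_set_scope.
Local Open Scope ring_scope.
Local Open Scope complex_scope.

Local Notation Re := complex.Re.
Local Notation Im := complex.Im.

(* The sigma-algebra of C is that of R * R, i.e. the Borel sigma-algebra of the
   plane, so that a C-valued function is measurable iff its real and imaginary
   parts are. *)
Section complex_measurable.
Context (R : realType).

Definition measurable_complex : set (set R[i]) :=
  [set A | measurable [set p : R * R | A (p.1 +i* p.2)]].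

Let m0 : measurable_complex set0. Proof. exact: measurable0. Qed.

Let mC A : measurable_complex A -> measurable_complex (~` A).
Proof. exact: measurableC. Qed.

Let mU (F : (set R[i])^nat) :
  (forall k, measurable_complex (F k)) -> measurable_complex (\bigcup_k F k).
Proof. exact: bigcupT_measurable. Qed.

HB.instance Definition _ := isPointed.Build R[i] 0.
HB.instance Definition _ :=
  @isMeasurable.Build default_measure_display R[i] measurable_complex m0 mC mU.

Lemma measurable_fun_complexP d (T : measurableType d) (f : T -> R[i]) :
  measurable_fun setT f <->
  measurable_fun setT (fun w => Re (f w)) /\
  measurable_fun setT (fun w => Im (f w)).
Proof.
split=> [mf|[mRe mIm]].
  split=> _ Y mY; rewrite setTI.
    have := mf measurableT [set z | Y (Re z)]; rewrite setTI; apply.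
    have := @measurable_fst _ _ (measurableTypeR R) (measurableTypeR R).
    by move=> /(_ measurableT Y mY); rewrite setTI.
  have := mf measurableT [set z | Y (Im z)]; rewrite setTI; apply.
  have := @measurable_snd _ _ (measurableTypeR R) (measurableTypeR R).
  by move=> /(_ measurableT Y mY); rewrite setTI.
move=> _ Y mY; rewrite setTI.
have := measurable_fun_pair mRe mIm => /(_ measurableT _ mY); rewrite setTI.
congr (measurable _); apply/funext => w; rewrite /preimage/=.
by case: (f w).
Qed.

Lemma measurable_normc : measurable_fun [set: R[i]] (@normc R).
Proof.
have [mRe mIm] := (measurable_fun_complexP (@id R[i])).1 (@measurable_id _ _ _).
rewrite (_ : @normc R =
  (fun z => Num.sqrt ((Re z) ^+ 2 + (Im z) ^+ 2))); last first.
  by apply/funext => -[].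
apply: (@measurableT_comp _ _ _ _ _ _ (@Num.sqrt R)).
  by apply: continuous_measurable_fun; exact: sqrt_continuous.
by apply: measurable_funD; exact: measurable_funX.
Qed.

End complex_measurable.

(* A separate name, since the ring structure that the library puts on
   [{mfun T >-> U}] is only for [U : realType]. *)
Definition mfunC d (T : measurableType d) (R : realType) := {mfun T >-> R[i]}.

Section mfun_complex.
Context d (T : measurableType d) (R : realType).

HB.instance Definition _ := Choice.on (mfunC T R).

Let ReD (x y : R[i]) : Re (x + y) = Re x + Re y.
Proof. by move: x y => [? ?] [? ?]. Qed.
Let ImD (x y : R[i]) : Im (x + y) = Im x + Im y.
Proof. by move: x y => [? ?] [? ?]. Qed.
Let ReN (x : R[i]) : Re (- x) = - Re x. Proof. by case: x. Qed.
Let ImN (x : R[i]) : Im (- x) = - Im x. Proof. by case: x. Qed.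
Let ReM (x y : R[i]) : Re (x * y) = Re x * Re y - Im x * Im y.
Proof. by move: x y => [? ?] [? ?]. Qed.
Let ImM (x y : R[i]) : Im (x * y) = Re x * Im y + Im x * Re y.
Proof. by move: x y => [? ?] [? ?]. Qed.

Implicit Types f g h : mfunC T R.

Let mRe f : measurable_fun setT (fun w => Re (f w)).
Proof. by have [] := (measurable_fun_complexP f).1 (measurable_funPT f). Qed.
Let mIm f : measurable_fun setT (fun w => Im (f w)).
Proof. by have [] := (measurable_fun_complexP f).1 (measurable_funPT f). Qed.

Let measurable_addC f g : measurable_fun setT (fun w => f w + g w).
Proof.
apply/measurable_fun_complexP; split.
  by rewrite (eq_fun (fun w => ReD (f w) (g w))); exact: measurable_funD.
by rewrite (eq_fun (fun w => ImD (f w) (g w))); exact: measurable_funD.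
Qed.

Let measurable_oppC f : measurable_fun setT (fun w => - f w).
Proof.
apply/measurable_fun_complexP; split.
  by rewrite (eq_fun (fun w => ReN (f w))); exact: measurableT_comp.
by rewrite (eq_fun (fun w => ImN (f w))); exact: measurableT_comp.
Qed.

Let measurable_mulC f g : measurable_fun setT (fun w => f w * g w).
Proof.
apply/measurable_fun_complexP; split.
  rewrite (eq_fun (fun w => ReM (f w) (g w))).
  by apply: measurable_funB; exact: measurable_funM.
rewrite (eq_fun (fun w => ImM (f w) (g w))).
by apply: measurable_funD; exact: measurable_funM.
Qed.

Definition mfunC_cst (c : R[i]) : mfunC T R := cst c.
Definition mfunC_add f g : mfunC T R :=
  HB.pack (fun w => f w + g w)
    (isMeasurableFun.Build _ _ _ _ (fun w => f w + g w) (measurable_addC f g)).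
Definition mfunC_opp f : mfunC T R :=
  HB.pack (fun w => - f w)
    (isMeasurableFun.Build _ _ _ _ (fun w => - f w) (measurable_oppC f)).
Definition mfunC_mul f g : mfunC T R :=
  HB.pack (fun w => f w * g w)
    (isMeasurableFun.Build _ _ _ _ (fun w => f w * g w) (measurable_mulC f g)).

Let addA : associative mfunC_add.
Proof. by move=> f g h; apply/mfuneqP => w; exact: addrA. Qed.
Let addC : commutative mfunC_add.
Proof. by move=> f g; apply/mfuneqP => w; exact: addrC. Qed.
Let add0 : left_id (mfunC_cst 0) mfunC_add.
Proof. by move=> f; apply/mfuneqP => w; exact: add0r. Qed.
Let addN : left_inverse (mfunC_cst 0) mfunC_opp mfunC_add.
Proof. by move=> f; apply/mfuneqP => w; exact: addNr. Qed.
Let mulA : associative mfunC_mul.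
Proof. by move=> f g h; apply/mfuneqP => w; exact: mulrA. Qed.
Let mulC : commutative mfunC_mul.
Proof. by move=> f g; apply/mfuneqP => w; exact: mulrC. Qed.
Let mul1 : left_id (mfunC_cst 1) mfunC_mul.
Proof. by move=> f; apply/mfuneqP => w; exact: mul1r. Qed.
Let mulDl : left_distributive mfunC_mul mfunC_add.
Proof. by move=> f g h; apply/mfuneqP => w; exact: mulrDl. Qed.

HB.instance Definition _ := GRing.isZmodule.Build (mfunC T R)
  addA addC add0 addN.
HB.instance Definition _ := GRing.Zmodule_isComPzRing.Build (mfunC T R)
  mulA mulC mul1 mulDl.

End mfun_complex.

Section quotient_ring.
Local Open Scope quotient_scope.
Context (M : comPzRingType) (e : equiv_rel M) (Q : eqQuotType e).
Hypothesis eD : forall x x' y y', e x x' -> e y y' -> e (x + y) (x' + y').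
Hypothesis eN : forall x x', e x x' -> e (- x) (- x').
Hypothesis eM : forall x x' y y', e x x' -> e y y' -> e (x * y) (x' * y').

Definition quot_add (x y : Q) : Q := \pi_Q (repr x + repr y).
Definition quot_opp (x : Q) : Q := \pi_Q (- repr x).
Definition quot_mul (x y : Q) : Q := \pi_Q (repr x * repr y).

Let e_repr x : e (repr (\pi_Q x)) x.
Proof. by apply/(@eqquotP _ e Q); rewrite reprK. Qed.

Lemma quot_addE x y : quot_add (\pi_Q x) (\pi_Q y) = \pi_Q (x + y).
Proof. by apply/(@eqquotP _ e Q); exact: eD. Qed.
Lemma quot_oppE x : quot_opp (\pi_Q x) = \pi_Q (- x).
Proof. by apply/(@eqquotP _ e Q); exact: eN. Qed.
Lemma quot_mulE x y : quot_mul (\pi_Q x) (\pi_Q y) = \pi_Q (x * y).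
Proof. by apply/(@eqquotP _ e Q); exact: eM. Qed.

Lemma quot_addA : associative quot_add.
Proof.
by elim/quotW=> x; elim/quotW=> y; elim/quotW=> z; rewrite !quot_addE addrA.
Qed.
Lemma quot_addC : commutative quot_add.
Proof. by elim/quotW=> x; elim/quotW=> y; rewrite !quot_addE addrC. Qed.
Lemma quot_add0 : left_id (\pi_Q 0) quot_add.
Proof. by elim/quotW=> x; rewrite quot_addE add0r. Qed.
Lemma quot_addN : left_inverse (\pi_Q 0) quot_opp quot_add.
Proof. by elim/quotW=> x; rewrite quot_oppE quot_addE addNr. Qed.
Lemma quot_mulA : associative quot_mul.
Proof.
by elim/quotW=> x; elim/quotW=> y; elim/quotW=> z; rewrite !quot_mulE mulrA.
Qed.
Lemma quot_mulC : commutative quot_mul.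
Proof. by elim/quotW=> x; elim/quotW=> y; rewrite !quot_mulE mulrC. Qed.
Lemma quot_mul1 : left_id (\pi_Q 1) quot_mul.
Proof. by elim/quotW=> x; rewrite quot_mulE mul1r. Qed.
Lemma quot_mulDl : left_distributive quot_mul quot_add.
Proof.
elim/quotW=> x; elim/quotW=> y; elim/quotW=> z.
by rewrite !(quot_addE, quot_mulE) mulrDl.
Qed.

End quotient_ring.

Section L0.
Local Open Scope quotient_scope.
Context d (T : measurableType d) (R : realType) (P : probability T R).

Definition L0R : Type := {mfun_ P, T >-> R}.
Definition L0C : Type := {mfun_ P, T >-> R[i]}.

HB.instance Definition _ := Choice.on L0R.
HB.instance Definition _ := EqQuotient.on L0R.
HB.instance Definition _ := Choice.on L0C.
HB.instance Definition _ := EqQuotient.on L0C.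

Definition L0R_fun (x : L0R) : T -> R := repr x.
Definition L0C_fun (x : L0C) : T -> R[i] := repr x.
Coercion L0R_fun : L0R >-> Funclass.
Coercion L0C_fun : L0C >-> Funclass.

Definition classR (f : {mfun T >-> R}) : L0R := \pi_L0R f.
Definition classC (f : mfunC T R) : L0C := \pi_L0C f.

Lemma classR_ae f : \forall w \ae P, classR f w = f w.
Proof.
have : repr (classR f) == f %[mod L0R] by rewrite reprK.
by rewrite eqmodE => /asboolP; apply: filterS => w; exact.
Qed.

Lemma classC_ae f : \forall w \ae P, classC f w = f w.
Proof.
have : repr (classC f) == f %[mod L0C] by rewrite reprK.
by rewrite eqmodE => /asboolP; apply: filterS => w; exact.
Qed.

Lemma L0R_eqP (x y : L0R) : x = y <-> \forall w \ae P, x w = y w.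
Proof.
split=> [->|xy]; first exact: aeW.
rewrite -[x]reprK -[y]reprK; apply/eqmodP/asboolP.
by apply: filterS xy.
Qed.

Lemma L0C_eqP (x y : L0C) : x = y <-> \forall w \ae P, x w = y w.
Proof.
split=> [->|xy]; first exact: aeW.
rewrite -[x]reprK -[y]reprK; apply/eqmodP/asboolP.
by apply: filterS xy.
Qed.

Let eRD (f f' g g' : {mfun T >-> R}) :
  ae_eq_op P f f' -> ae_eq_op P g g' -> ae_eq_op P (f + g) (f' + g').
Proof.
move=> /asboolP ff' /asboolP gg'; apply/asboolP.
by apply: filterS2 ff' gg' => w /(_ I) ffw /(_ I) ggw _; congr (_ + _).
Qed.
Let eRN (f f' : {mfun T >-> R}) :
  ae_eq_op P f f' -> ae_eq_op P (- f) (- f').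
Proof.
move=> /asboolP ff'; apply/asboolP.
by apply: filterS ff' => w /(_ I) ffw _; congr (- _).
Qed.
Let eRM (f f' g g' : {mfun T >-> R}) :
  ae_eq_op P f f' -> ae_eq_op P g g' -> ae_eq_op P (f * g) (f' * g').
Proof.
move=> /asboolP ff' /asboolP gg'; apply/asboolP.
by apply: filterS2 ff' gg' => w /(_ I) ffw /(_ I) ggw _; congr (_ * _).
Qed.
Let eCD (f f' g g' : mfunC T R) :
  ae_eq_op P f f' -> ae_eq_op P g g' ->
  ae_eq_op P (f + g : mfunC T R) (f' + g').
Proof.
move=> /asboolP ff' /asboolP gg'; apply/asboolP.
by apply: filterS2 ff' gg' => w /(_ I) ffw /(_ I) ggw _; congr (_ + _).
Qed.
Let eCN (f f' : mfunC T R) :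
  ae_eq_op P f f' -> ae_eq_op P (- f : mfunC T R) (- f').
Proof.
move=> /asboolP ff'; apply/asboolP.
by apply: filterS ff' => w /(_ I) ffw _; congr (- _).
Qed.
Let eCM (f f' g g' : mfunC T R) :
  ae_eq_op P f f' -> ae_eq_op P g g' ->
  ae_eq_op P (f * g : mfunC T R) (f' * g').
Proof.
move=> /asboolP ff' /asboolP gg'; apply/asboolP.
by apply: filterS2 ff' gg' => w /(_ I) ffw /(_ I) ggw _; congr (_ * _).
Qed.

HB.instance Definition _ := GRing.isZmodule.Build L0R
  (@quot_addA {mfun T >-> R} _ L0R eRD) (@quot_addC {mfun T >-> R} _ L0R eRD)
  (@quot_add0 {mfun T >-> R} _ L0R eRD)
  (@quot_addN {mfun T >-> R} _ L0R eRD eRN).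
HB.instance Definition _ := GRing.Zmodule_isComPzRing.Build L0R
  (@quot_mulA {mfun T >-> R} _ L0R eRM) (@quot_mulC {mfun T >-> R} _ L0R eRM)
  (@quot_mul1 {mfun T >-> R} _ L0R eRM)
  (@quot_mulDl {mfun T >-> R} _ L0R eRD eRM).

HB.instance Definition _ := GRing.isZmodule.Build L0C
  (@quot_addA (mfunC T R) _ L0C eCD) (@quot_addC (mfunC T R) _ L0C eCD)
  (@quot_add0 (mfunC T R) _ L0C eCD) (@quot_addN (mfunC T R) _ L0C eCD eCN).
HB.instance Definition _ := GRing.Zmodule_isComPzRing.Build L0C
  (@quot_mulA (mfunC T R) _ L0C eCM) (@quot_mulC (mfunC T R) _ L0C eCM)
  (@quot_mul1 (mfunC T R) _ L0C eCM)
  (@quot_mulDl (mfunC T R) _ L0C eCD eCM).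

End L0.

Section L0_order_norm.
Context d (T : measurableType d) (R : realType) (P : probability T R).

Definition L0R_le (x y : L0R P) : bool := `[< \forall w \ae P, x w <= y w >].

Let le_refl : reflexive L0R_le.
Proof. by move=> x; apply/asboolP; exact: aeW. Qed.

Let le_anti : antisymmetric L0R_le.
Proof.
move=> x y /andP[/asboolP xy /asboolP yx]; apply/L0R_eqP.
by apply: filterS2 xy yx => w xy yx; apply/le_anti/andP.
Qed.

Let le_trans : transitive L0R_le.
Proof.
move=> y x z /asboolP xy /asboolP yz; apply/asboolP.
by apply: filterS2 xy yz => w; exact: le_trans.
Qed.

HB.instance Definition _ := Order.Le_isPOrder.Build ring_display (L0R P)
  le_refl le_anti le_trans.

Lemma L0R_leP (x y : L0R P) : x <= y <-> \forall w \ae P, x w <= y w.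
Proof. by split=> /asboolP. Qed.

(* Strict positivity almost surely, which is stronger than the strict order
   [0 < x] of [L0R P] (the latter only says 0 <= x and x <> 0). *)
Definition L0R_pos (x : L0R P) : Prop := \forall w \ae P, 0 < x w.

HB.instance Definition _ :=
  isMeasurableFun.Build _ _ _ _ (@normc R) (@measurable_normc R).

Definition L0_norm (x : L0C P) : L0R P := classR P (@normc R \o repr x).

Definition L0_cst (c : R[i]) : L0C P := classC P (mfunC_cst T c).

Let measurable_indicC (A : set T) (mA : measurable A) :
  measurable_fun setT (fun w => (\1_A w : R)%:C).
Proof.
by apply/measurable_fun_complexP; split=> //; exact: measurable_indic.
Qed.

Definition mfunC_indic (A : set T) (mA : measurable A) : mfunC T R :=
  HB.pack (fun w => (\1_A w : R)%:C)
    (isMeasurableFun.Build _ _ _ _ _ (measurable_indicC mA)).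

Definition L0_indic (A : set T) (mA : measurable A) : L0C P :=
  classC P (mfunC_indic mA).

Lemma L0R_add_ae (x y : L0R P) : \forall w \ae P, (x + y : L0R P) w = x w + y w.
Proof. exact: classR_ae. Qed.
Lemma L0R_mul_ae (x y : L0R P) : \forall w \ae P, (x * y : L0R P) w = x w * y w.
Proof. exact: classR_ae. Qed.
Lemma L0R_0_ae : \forall w \ae P, (0 : L0R P) w = 0.
Proof. exact: classR_ae. Qed.
Lemma L0R_1_ae : \forall w \ae P, (1 : L0R P) w = 1.
Proof. exact: classR_ae. Qed.
Lemma L0C_add_ae (x y : L0C P) : \forall w \ae P, (x + y : L0C P) w = x w + y w.
Proof. exact: classC_ae. Qed.
Lemma L0C_mul_ae (x y : L0C P) : \forall w \ae P, (x * y : L0C P) w = x w * y w.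
Proof. exact: classC_ae. Qed.
Lemma L0C_0_ae : \forall w \ae P, (0 : L0C P) w = 0.
Proof. exact: classC_ae. Qed.
Lemma L0C_1_ae : \forall w \ae P, (1 : L0C P) w = 1.
Proof. exact: classC_ae. Qed.
Lemma L0_norm_ae (x : L0C P) : \forall w \ae P, L0_norm x w = normc (x w).
Proof. exact: classR_ae. Qed.

End L0_order_norm.

HB.mixin Record Lmodule_isRNModule d (T : measurableType d) (R : realType)
    (P : probability T R) E & GRing.Lmodule (L0C P) E := {
  rnorm : E -> L0R P;
  rnorm_ge0 : forall x, 0 <= rnorm x;
  rnorm_eq0 : forall x, rnorm x = 0 <-> x = 0;
  rnormZ : forall (a : L0C P) x, rnorm (a *: x) = L0_norm a * rnorm x;
  ler_rnormD : forall x y, rnorm (x + y) <= rnorm x + rnorm y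
}.

#[short(type=rnModuleType)]
HB.structure Definition RNModule d (T : measurableType d) (R : realType)
    (P : probability T R) :=
  {E of GRing.Lmodule (L0C P) E & Lmodule_isRNModule d T R P E}.

Section RNModule_theory.
Context d (T : measurableType d) (R : realType) (P : probability T R).
Context (E : rnModuleType P).

(* The sets [A n] may be empty: finite partitions are included. *)
Definition countable_concatenation : Prop :=
  forall (x : nat -> E) (A : nat -> set T) (mA : forall n, measurable (A n)),
    trivIset setT A -> \bigcup_n A n = setT ->
    exists y : E, forall n, L0_indic P (mA n) *: y = L0_indic P (mA n) *: x n.

(* Linearity over the field C, which acts on E through the constant classes;
   for bounded f this is the same as linearity over L0C. *)
Definition C_linear (f : E -> L0C P) : Prop :=
  forall c x y, f (L0_cst P c *: x + y) = L0_cst P c * f x + f y.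

Definition rbounded (f : E -> L0C P) : Prop :=
  exists2 b : L0R P, 0 <= b & forall x, L0_norm (f x) <= b * rnorm x.

Definition rconj_pred : {pred E -> (L0C P)^o} :=
  fun f => `[< C_linear f /\ rbounded f >].

Let aeI (A B : set T) : (\forall w \ae P, A w) -> (\forall w \ae P, B w) ->
  \forall w \ae P, A w /\ B w.
Proof. exact: filterI. Qed.

Let normc_ge0 (z : R[i]) : 0 <= normc z.
Proof. by case: z => x y; exact: sqrtr_ge0. Qed.

Let rconj0 : 0 \in rconj_pred.
Proof.
apply/asboolP; split.
  by move=> c x y; rewrite /GRing.zero/= mulr0 addr0.
exists 0 => // x; rewrite mul0r; apply/L0R_leP.
apply: filterS3 (L0_norm_ae (0 : L0C P)) (L0C_0_ae P) (L0R_0_ae P).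
by move=> w /= + zC zR; rewrite zC zR normc0 => ->.
Qed.

Let rconjD : {in rconj_pred &, forall f g, f + g \in rconj_pred}.
Proof.
move=> f g /asboolP[fl [b b0 fb]] /asboolP[gl [c c0 gc]].
apply/asboolP; split.
  move=> k x y; rewrite /GRing.add/= fl gl mulrDr.
  by rewrite addrACA.
exists (b + c).
  apply/L0R_leP; move/L0R_leP in b0; move/L0R_leP in c0.
  have h := aeI (L0R_0_ae P) (L0R_add_ae b c).
  apply: filterS3 b0 c0 h => w b0 c0 [z0 ->].
  by move: b0 c0; rewrite z0; exact: addr_ge0.
move=> x; rewrite mulrDl; apply/L0R_leP.
have /L0R_leP fx := fb x; have /L0R_leP gx := gc x.
have h1 := aeI (L0_norm_ae (f x)) (L0_norm_ae (g x)).
have h2 := aeI (L0_norm_ae (f x + g x : L0C P)) (L0C_add_ae (f x) (g x)).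
have h3 := L0R_add_ae (b * rnorm x) (c * rnorm x).
apply: filterS3 (aeI fx gx) h3 (aeI h1 h2).
move=> w [fx' gx'] h3' [[nf ng] [n a]].
rewrite h3' [X in X <= _]n a (le_trans (le_normcD _ _))//.
by rewrite lerD// -?nf -?ng.
Qed.

Let rconjZ (a : L0C P) : {in rconj_pred, forall f, a *: f \in rconj_pred}.
Proof.
move=> f /asboolP[fl [b b0 fb]]; apply/asboolP; split.
  move=> k x y; rewrite /GRing.scale/= fl /GRing.scale/= mulrDr.
  by rewrite mulrCA.
exists (L0_norm a * b).
  apply/L0R_leP; move/L0R_leP in b0.
  have h := aeI (L0R_0_ae P) (L0R_mul_ae (L0_norm a) b).
  apply: filterS3 b0 (L0_norm_ae a) h => w b0 na [z0 ->].
  by move: b0; rewrite z0 na => b0; rewrite mulr_ge0// normc_ge0.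
move=> x; rewrite -mulrA; apply/L0R_leP.
have /L0R_leP fx := fb x.
have h1 := aeI (L0_norm_ae a) (L0_norm_ae (f x)).
have h2 := aeI (L0_norm_ae (a * f x : L0C P)) (L0C_mul_ae a (f x)).
have h3 := L0R_mul_ae (L0_norm a) (b * rnorm x).
apply: filterS3 fx h3 (aeI h1 h2) => w fx' h3' [[na nf] [n m]].
rewrite h3' [X in X <= _]n m normcM na ler_wpM2l ?normc_ge0//.
by rewrite -nf.
Qed.

Let rconj_submod : submod_closed rconj_pred.
Proof.
by split=> [|a f g fE gE]; [exact: rconj0|apply: rconjD => //; exact: rconjZ].
Qed.

HB.instance Definition _ :=
  GRing.isSubmodClosed.Build _ _ rconj_pred rconj_submod.

Record rconj := RConj {
  rconj_fun :> E -> (L0C P)^o;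
  rconj_funP : rconj_fun \in rconj_pred }.

HB.instance Definition _ := [isSub for rconj_fun].
HB.instance Definition _ := [Choice of rconj by <:].
HB.instance Definition _ := [SubChoice_isSubLmodule of rconj by <:].

Lemma rconj_addE (f g : rconj) x : (f + g : rconj) x = f x + g x.
Proof. by []. Qed.
Lemma rconj_scaleE a (f : rconj) x : (a *: f : rconj) x = a * f x.
Proof. by []. Qed.

(* The least upper bound in [L0R P] for almost sure inequality. *)
Definition rconj_norm (f : rconj) : L0R P :=
  supremum 0 [set L0_norm (f y) | y in [set y : E | rnorm y <= 1]].

End RNModule_theory.

(* Main.v *)
(* The forward direction is [|g x| <= ||g|| ||x||] applied to
   [g = \sum_k lam_k f_k].  For the converse, write [phi x] for the tuple of
   the [f_k x] and let [delta] be the essential infimum of [|xi - phi x|^2] over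
   the ball [||x|| <= beta].  Concatenation yields a point [x] of the ball whose
   value is at most [delta + s^2]; comparing [x] with [x + s (z - x)] for [z] in
   the ball gives [Re (g z) <= Re (g x) + O(s)] where
   [g = \sum_k conj (xi_k - f_k x) f_k], hence [beta ||g|| <= Re (g x) + O(s)].
   On the other hand the hypothesis bounds
   [Re (\sum_k conj (xi_k - f_k x) xi_k) >= Re (g x) + delta] by [beta ||g||],
   so [delta = O(s)], that is [delta = 0]: the equations are solvable in the
   ball up to an arbitrarily small error.  Gram-Schmidt elimination provides
   finitely many vectors of [E] whose images under [phi] span the range of
   [phi] with coefficients in the span of the [f_k]; a small combination of
   these vectors removes the error exactly, at the cost of [eps] in the norm. *)

Require Import Defs.
From HB Require Import structures.
From mathcomp Require Import all_boot all_order all_algebra.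
From mathcomp Require Import complex.
From mathcomp Require Import all_classical all_reals all_analysis.
From mathcomp Require Import measurable_realfun lra ring.

Set Implicit Arguments.
Unset Strict Implicit.
Unset Printing Implicit Defensive.
Import Order.TTheory GRing.Theory Num.Theory.
Import ComplexField.Normc.

Local Open Scope classical_set_scope.
Local Open Scope ring_scope.

(** * Complex moduli, near-minimality and rational approximation *)

Section normc.
Variable R : rcfType.
Implicit Types z u : R[i].

Lemma normc_ge0 z : 0 <= normc z.
Proof. by case: z => a b; exact: sqrtr_ge0. Qed.

Lemma normc_real (a : R) : normc (a%:C)%C = `|a|.
Proof. by rewrite /= expr0n addr0 sqrtr_sqr. Qed.

Lemma normc_conj z : normc (conjc z) = normc z.
Proof. by case: z => a b /=; rewrite sqrrN. Qed.

Lemma sqr_normcE z : normc z ^+ 2 = complex.Re z ^+ 2 + complex.Im z ^+ 2.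
Proof. by case: z => a b /=; rewrite sqr_sqrtr// addr_ge0 ?sqr_ge0. Qed.

Lemma Re_le_normc z : complex.Re z <= normc z.
Proof.
case: z => a b /=; apply: (le_trans (ler_norm _)).
by rewrite -[leLHS]sqrtr_sqr ler_wsqrtr// lerDl sqr_ge0.
Qed.

Lemma ReD z u : complex.Re (z + u) = complex.Re z + complex.Re u.
Proof. by case: z; case: u. Qed.

Lemma Re_sum (I : Type) (r : seq I) (F : I -> R[i]) :
  complex.Re (\sum_(i <- r) F i) = \sum_(i <- r) complex.Re (F i).
Proof. by elim/big_rec2: _ => // i y z _ <-; rewrite ReD. Qed.

Lemma normc_sum (I : Type) (r : seq I) (F : I -> R[i]) :
  normc (\sum_(i <- r) F i) <= \sum_(i <- r) normc (F i).
Proof.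
elim/big_rec2: _ => [|i y z _ h]; first by rewrite normc0.
by apply: (le_trans (le_normcD _ _)); rewrite lerD2l.
Qed.

Lemma normc_sqrB (s : R) z u : normc (z - (s%:C)%C * u) ^+ 2 =
  normc z ^+ 2 - 2 * s * complex.Re (conjc z * u) + s ^+ 2 * normc u ^+ 2.
Proof. by rewrite !sqr_normcE; case: z => a b; case: u => c e /=; ring. Qed.

Lemma Re_conjcM z : complex.Re (conjc z * z) = normc z ^+ 2.
Proof. by rewrite sqr_normcE; case: z => a b /=; ring. Qed.

Lemma conjcM_normc z : conjc z * z = (normc z ^+ 2)%:C%C.
Proof.
rewrite sqr_normcE; case: z => a b; apply/eqP.
by rewrite eq_complex/=; apply/andP; split; apply/eqP; ring.
Qed.

Lemma normc_le_ReIm z :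
  normc z <= `|complex.Re z| + `|complex.Im z|.
Proof.
rewrite -(@ler_pXn2r _ 2)// ?nnegrE ?normc_ge0 ?addr_ge0//.
rewrite sqr_normcE sqrrD !real_normK ?num_real//.
by rewrite addrAC lerDl mulrn_wge0// mulr_ge0.
Qed.

(** First-order optimality with an error: when [v] is within [s ^+ 2] of the lower bound [delta],
    expanding the squares of [v k - s * u k] and dividing by [2 * s] bounds the slope in the
    direction [u]. *)
Lemma Re_le_of_almost_minimal (n : nat) (v u : 'I_n -> R[i])
    (s delta D : R) : 0 < s ->
  delta <= \sum_k normc (v k - (s%:C)%C * u k) ^+ 2 ->
  \sum_k normc (v k) ^+ 2 <= delta + s ^+ 2 -> \sum_k normc (u k) ^+ 2 <= D ->
  complex.Re (\sum_k conjc (v k) * u k) <= s * (1 + D) / 2.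
Proof.
move=> s0 dle vle uD.
have : \sum_k normc (v k - (s%:C)%C * u k) ^+ 2 =
    \sum_k normc (v k) ^+ 2 - 2 * s * complex.Re (\sum_k conjc (v k) * u k)
    + s ^+ 2 * \sum_k normc (u k) ^+ 2.
  rewrite Re_sum !mulr_sumr -sumrN -!big_split/=; apply: eq_bigr => k _.
  exact: normc_sqrB.
move=> vuE; rewrite vuE in dle.
have : s ^+ 2 * \sum_k normc (u k) ^+ 2 <= s ^+ 2 * D by rewrite ler_wpM2l ?sqr_ge0.
set X := complex.Re _ in dle *; set Y := s ^+ 2 * \sum_k _ in dle *; move=> YD.
rewrite -(ler_pM2l s0); lra.
Qed.

End normc.

(** Letting errors run through [c / m.+1] rather than all positive reals leaves only countably many
    null sets in almost sure arguments. *)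
Lemma le0_harmonic (R : realType) (x c : R) :
  (forall m : nat, x <= c / m.+1%:R) -> x <= 0.
Proof.
move=> xc; rewrite leNgt; apply/negP => x0.
have c0 : 0 <= c / x.
  by rewrite divr_ge0 ?(ltW x0)//; have := xc 0%N; rewrite divr1; lra.
have := xc (Num.bound (c / x)).
have := archi_boundP c0; rewrite ltr_pdivrMr//.
set m := Num.bound _ => cx; rewrite ler_pdivlMr ?ltr0n//.
by rewrite mulrC -natr1 mulrDl mul1r; lra.
Qed.

(** Supplies a countable dense set of constants, so that the exceptional null sets met in [rconjZ]
    can be united. *)
Lemma ratc_dense (R : realType) (z : R[i]) (m : nat) : exists q : rat * rat,
  normc (z - (ratr q.1 +i* ratr q.2)%C) <= 2 / m.+1%:R.
Proof.
have close (a : R) : exists q : rat, `|a - ratr q| <= m.+1%:R^-1.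
  have : a < a + m.+1%:R^-1 by rewrite ltrDl invr_gt0 ltr0n.
  move=> /rat_in_itvoo[q]; rewrite in_itv/= => /andP[aq qa]; exists q.
  by rewrite distrC ger0_norm ?subr_ge0 ?(ltW aq)// lerBlDl ltW.
have [q1 q1P] := close (complex.Re z); have [q2 q2P] := close (complex.Im z).
exists (q1, q2); apply: (le_trans (normc_le_ReIm _)).
by case: z q1P q2P => a b /= q1P q2P; rewrite mulr_natl mulr2n lerD.
Qed.

(** * Pointwise representatives of classes *)

Section L0_pointwise.
Context d (T : measurableType d) (R : realType) (P : probability T R).

Lemma L0R_opp_ae (x : L0R P) : \forall w \ae P, (- x : L0R P) w = - x w.
Proof. exact: classR_ae. Qed.

Lemma L0C_opp_ae (x : L0C P) : \forall w \ae P, (- x : L0C P) w = - x w.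
Proof. exact: classC_ae. Qed.

Lemma L0C_sub_ae (a b : L0C P) : \forall w \ae P, (a - b : L0C P) w = a w - b w.
Proof. by apply: filterS2 (L0C_add_ae a (- b)) (L0C_opp_ae b) => w -> ->. Qed.

Lemma L0C_sum_ae (I : Type) (r : seq I) (F : I -> L0C P) :
  \forall w \ae P, (\sum_(i <- r) F i : L0C P) w = \sum_(i <- r) F i w.
Proof.
elim: r => [|i r IH].
  by near=> w; rewrite !big_nil; near: w; exact: L0C_0_ae.
near=> w; rewrite !big_cons (near (L0C_add_ae _ _) w)//; congr (_ + _).
by near: w.
Unshelve. all: by end_near. Qed.

Lemma L0R_sum_ae (I : Type) (r : seq I) (F : I -> L0R P) :
  \forall w \ae P, (\sum_(i <- r) F i : L0R P) w = \sum_(i <- r) F i w.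
Proof.
elim: r => [|i r IH].
  by near=> w; rewrite !big_nil; near: w; exact: L0R_0_ae.
near=> w; rewrite !big_cons (near (L0R_add_ae _ _) w)//; congr (_ + _).
by near: w.
Unshelve. all: by end_near. Qed.

Lemma ae_forall_fin (I : finType) (Q : I -> T -> Prop) :
  (forall i, \forall w \ae P, Q i w) -> \forall w \ae P, forall i, Q i w.
Proof.
exact: filter_forall.
Qed.

Lemma measurable_L0R (x : L0R P) : measurable_fun setT x.
Proof. exact: (measurable_funPT (repr x)). Qed.

Lemma measurable_L0C (x : L0C P) : measurable_fun setT x.
Proof. exact: (measurable_funPT (repr x)). Qed.

Lemma L0R_lift (g : T -> R) : measurable_fun setT g ->
  exists x : L0R P, \forall w \ae P, x w = g w.
Proof.
move=> mg; pose G : {mfun T >-> R} :=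
  HB.pack g (isMeasurableFun.Build _ _ _ _ g mg).
by exists (classR P G); exact: classR_ae.
Qed.

Lemma L0C_lift (g : T -> R[i]) : measurable_fun setT g ->
  exists x : L0C P, \forall w \ae P, x w = g w.
Proof.
move=> mg; pose G : mfunC T R :=
  HB.pack g (isMeasurableFun.Build _ _ _ _ g mg).
by exists (classC P G); exact: classC_ae.
Qed.

Lemma measurable_conjc (g : T -> R[i]) :
  measurable_fun setT g -> measurable_fun setT (fun w => conjc (g w)).
Proof.
move=> /measurable_fun_complexP[mRe mIm]; apply/measurable_fun_complexP; split.
  by apply: eq_measurable_fun mRe => w _; case: (g w).
apply: eq_measurable_fun (measurableT_comp (@oppr_measurable _ _) mIm).
by move=> w _ /=; case: (g w).
Qed.

Lemma measurable_realC (g : T -> R) :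
  measurable_fun setT g -> measurable_fun setT (fun w => (g w)%:C%C).
Proof. by move=> mg; apply/measurable_fun_complexP; split. Qed.

(* The real function [x^-1] is written as a power in order to get its
   measurability on the nonnegative reals. *)
Lemma measurable_invc (g : T -> R[i]) :
  measurable_fun setT g -> measurable_fun setT (fun w => (g w)^-1).
Proof.
move=> mg; have /measurable_fun_complexP[mRe mIm] := mg.
have mN : measurable_fun setT (fun w => (normc (g w) ^+ 2) `^ (-1)).
  have mn : measurable_fun setT (fun w => normc (g w)).
    exact: (measurableT_comp (@measurable_normc R) mg).
  have mn2 := measurable_funX 2 mn.
  exact: (measurableT_comp (measurable_powR (-1)) mn2).
have invE w : (normc (g w) ^+ 2) `^ (-1) = (normc (g w) ^+ 2)^-1.
  by rewrite powR_inv1// sqr_ge0.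
apply/measurable_fun_complexP; split.
  apply: eq_measurable_fun (measurable_funM mRe mN) => w _ /=.
  by rewrite invE sqr_normcE; case: (g w).
apply: eq_measurable_fun (measurable_funM (measurable_funN mIm) mN) => w _ /=.
by rewrite invE sqr_normcE; case: (g w) => a b /=; rewrite mulNr.
Qed.

Lemma L0C_conj_ex (x : L0C P) :
  exists y : L0C P, \forall w \ae P, y w = conjc (x w).
Proof. by apply: L0C_lift; apply: measurable_conjc; exact: measurable_L0C. Qed.

(** Since [0^-1 = 0], the product [x * y] is the indicator of the support of [x]; this replaces
    division by classes that may vanish on part of the space. *)
Lemma L0C_inv_ex (x : L0C P) : exists y : L0C P, \forall w \ae P, y w = (x w)^-1.
Proof. by apply: L0C_lift; apply: measurable_invc; exact: measurable_L0C. Qed.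

Lemma L0C_real_ex (x : L0R P) :
  exists y : L0C P, \forall w \ae P, y w = (x w)%:C%C.
Proof. by apply: L0C_lift; apply: measurable_realC; exact: measurable_L0R. Qed.

Lemma L0_cst_ae (c : R[i]) : \forall w \ae P, (L0_cst P c) w = c.
Proof. exact: classC_ae. Qed.

Lemma L0_indic_ae (A : set T) (mA : measurable A) :
  \forall w \ae P, (L0_indic P mA) w = (\1_A w : R)%:C%C.
Proof. exact: classC_ae. Qed.

Lemma L0R_ge0_ae (x : L0R P) : 0 <= x -> \forall w \ae P, 0 <= x w.
Proof.
move=> /L0R_leP x0; near=> w.
by rewrite -(near (L0R_0_ae P) w)//; near: w.
Unshelve. all: by end_near. Qed.

Lemma L0R_pos_cst (c : R) : 0 < c ->
  exists2 e : L0R P, L0R_pos e & \forall w \ae P, e w = c.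
Proof.
move=> c0.
have [e eE] := L0R_lift (measurable_cst c : measurable_fun [set: T] _).
by exists e => //; apply: filterS eE => w ->.
Qed.

End L0_pointwise.

(** * Essential suprema and Dedekind completeness *)

Section dedekind.
Context d (T : measurableType d) (R : realType) (P : probability T R).

Lemma ae_forall_countable (I : countType) (Q : I -> T -> Prop) :
  (forall i, \forall w \ae P, Q i w) -> \forall w \ae P, forall i, Q i w.
Proof.
move=> QP.
have : \forall w \ae P, forall m : nat, if unpickle m is Some i then Q i w else True.
  by apply: ae_foralln => m; case: unpickle => [i|]; [exact: QP|exact: aeW].
by apply: filterS => w Qw i; have := Qw (pickle i); rewrite pickleK.
Qed.

Lemma measurable_L0R_gt (x : L0R P) (q : R) : measurable [set w | q < x w].
Proof.
have := measurable_L0R x measurableT (measurable_itv `]q, +oo[).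
by rewrite setTI; congr measurable; apply/seteqP; split=> w /=; rewrite in_itv/= andbT.
Qed.

Let p (A : set T) : R := fine (P A).

Let p_le1 A : measurable A -> p A <= 1.
Proof.
move=> mA; rewrite -lee_fin fineK; first exact: probability_le1.
exact: fin_num_measure.
Qed.

Let pU A B C : measurable A -> measurable B -> measurable C -> A `&` B = set0 ->
  A `|` B `<=` C -> p A + p B <= p C.
Proof.
move=> mA mB mC AB ABC.
rewrite -lee_fin EFinD !fineK ?fin_num_measure//.
rewrite -measureU//.
by apply: le_measure => //; rewrite inE//; exact: measurableU.
Qed.

(* Any family has a countable subfamily [s] such that, for every rational [q],
   [{sup_k s_k > q}] has the largest possible probability; the supremum of [s]
   is then an essential upper bound of the whole family. *)
Lemma L0R_dedekind (S : set (L0R P)) (b : L0R P) : S !=set0 -> ubound S b ->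
  exists (s : nat -> L0R P) (u : L0R P), [/\ forall k, S (s k), ubound S u &
    \forall w \ae P, forall e, 0 < e -> exists k, u w - e < s k w].
Proof.
move=> [s0 Ss0] Sb.
pose U (x : nat -> L0R P) (q : rat) := \bigcup_k [set w | ratr q < x k w].
have mU x q : measurable (U x q).
  by apply: bigcupT_measurable => k; exact: measurable_L0R_gt.
pose V q := [set p (U x q) | x in [set x | forall k, S (x k)]].
have supV q : has_sup (V q).
  split; first by exists (p (U (fun=> s0) q)), (fun=> s0).
  by exists 1 => _ [x _ <-]; exact: p_le1.
have /choice[F FP] : forall qj : rat * nat, exists x : nat -> L0R P,
    (forall k, S (x k)) /\ sup (V qj.1) - qj.2.+1%:R^-1 < p (U x qj.1).
  move=> [q j]; have j0 : (0 : R) < j.+1%:R^-1 by rewrite invr_gt0 ltr0n.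
  by have [_ [x Sx <-] ?] := sup_adherent j0 (supV q); exists x.
(* All members of all the near-optimal families [F (q, j)] are listed in one sequence; an index that
   codes nothing gets the default [s0]. *)
pose s m := if @unpickle (rat * nat * nat)%type m is Some qjk then F qjk.1 qjk.2 else s0.
have Ss m : S (s m) by rewrite /s; case: unpickle => // qjk; apply: (FP _).1.
have sb : \forall w \ae P, forall m, s m w <= b w.
  by apply: ae_foralln => m; apply/L0R_leP; exact: Sb.
(* Truncation at [b] bounds the sequence at every point, not only almost everywhere, so that the
   pointwise [sup] is a genuine supremum and is measurable. *)
pose h (m : nat) (w : T) := Num.min (s m w) (b w).
have hb w : has_ubound (range (h ^~ w)).
  by exists (b w) => _ [m _ <-]; rewrite /h ge_min lexx orbT.
have [u uE] : exists u : L0R P, \forall w \ae P, u w = sup (range (h ^~ w)).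
  apply: L0R_lift.
  rewrite (_ : (fun w => _) = (fun w => sups (h ^~ w) 0)); last first.
    apply/funext => w; rewrite /sups /sdrop/=; congr sup.
    by apply/seteqP; split=> _ [m _ <-]; exists m.
  apply: measurable_fun_sups => // m.
  by apply: measurable_minr; exact: measurable_L0R.
have hs w : has_sup (range (h ^~ w)) by split=> //; exists (h 0 w), 0%N.
have su : \forall w \ae P, forall m, s m w <= u w.
  near=> w => m; rewrite (near uE w)//.
  have -> : s m w = h m w by rewrite /h min_l//; move: m; near: w.
  by apply: ub_le_sup => //; exists m.
exists s, u; split => //; last first.
  near=> w => e e0; have [_ [m _ <-]] := sup_adherent e0 (hs w).
  rewrite -(near uE w)// => um; exists m; apply: (lt_le_trans um).
  by rewrite /h ge_min lexx.
suff uS (x : L0R P) : S x -> x <= u by move=> x; exact: uS.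
move=> Sx; apply/L0R_leP.
pose N (q : rat) := [set w | ratr q < x w] `\` \bigcup_m [set w | ratr q < s m w].
have mN q : measurable (N q).
  apply: measurableD; first exact: measurable_L0R_gt.
  by apply: bigcupT_measurable => k; exact: measurable_L0R_gt.
have N0 q : P (N q) = 0%E.
  suff : p (N q) <= 0.
    rewrite -lee_fin fineK ?fin_num_measure// => h0.
    by apply/eqP; rewrite eq_le h0 measure_ge0.
  apply: (@le0_harmonic _ _ 1) => j; rewrite mul1r.
  (* Prepending [x] to [F (q, j)] enlarges its event by at least [N q], yet that event was within
     [j.+1%:R^-1] of the largest probability; hence [p (N q)] is at most [j.+1%:R^-1]. *)
  pose x' k := if k is k'.+1 then F (q, j) k' else x.
  have /(ub_le_sup (supV q).2) x'q : V q (p (U x' q)).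
    by exists x' => // -[|k]//=; apply: (FP _).1.
  have [_ /= Fq] := FP (q, j).
  have : p (U (F (q, j)) q) + p (N q) <= p (U x' q).
    apply: pU => //.
      apply/seteqP; split=> // w [[k _ /= kw] [_ []]].
      by exists (pickle (q, j, k)) => //=; rewrite /s pickleK.
    by move=> w [[k _ kw]|[xw _]]; [exists k.+1|exists 0%N].
  move=> /le_trans /(_ x'q) pN; apply: ltW.
  rewrite -(ltrD2l (p (U (F (q, j)) q))); apply: le_lt_trans pN _.
  by rewrite -ltrBlDr.
have : \forall w \ae P, forall q, ~ N q w.
  apply: ae_forall_countable => q; exists (N q); split=> // w /=.
  by move/contrapT.
(* A rational strictly between [u w] and [x w] would put [w] in a null set [N q]. *)
apply: filterS2 su => w sw Nw; rewrite leNgt; apply/negP => /rat_in_itvoo[q].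
rewrite in_itv/= => /andP[uq qx]; apply: (Nw q); split=> // -[m _ /= qs].
by have := lt_trans uq qs; rewrite ltNge sw.
Unshelve. all: by end_near. Qed.

End dedekind.

(** * Linearity of bounded functionals over [L0C] *)

Section rconj_theory.
Context d (T : measurableType d) (R : realType) (P : probability T R).
Context (E : rnModuleType P).
Implicit Types (x y : E) (f g : rconj E) (a : L0C P).

Lemma rnorm_ge0_ae x : \forall w \ae P, 0 <= rnorm x w.
Proof. exact/L0R_ge0_ae/rnorm_ge0. Qed.

Lemma rnormD_ae x y : \forall w \ae P, rnorm (x + y) w <= rnorm x w + rnorm y w.
Proof.
have /L0R_leP := ler_rnormD x y; apply: filterS2 (L0R_add_ae (rnorm x) (rnorm y)).
by move=> w ->.
Qed.

Lemma rnormZ_ae a x : \forall w \ae P, rnorm (a *: x) w = normc (a w) * rnorm x w.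
Proof.
rewrite rnormZ; apply: filterS2 (L0R_mul_ae (L0_norm a) (rnorm x)) (L0_norm_ae a).
by move=> w -> ->.
Qed.

Lemma rconj_boundP f : exists2 b : L0R P, 0 <= b &
  forall x, \forall w \ae P, normc ((f x : L0C P) w) <= b w * rnorm x w.
Proof.
have /asboolP[_ [b b0 fb]] := rconj_funP f; exists b => // x.
have /L0R_leP := fb x; apply: filterS3 (L0_norm_ae (f x)) (L0R_mul_ae b (rnorm x)).
by move=> w -> ->.
Qed.

Lemma rconjD f x y : f (x + y) = f x + f y.
Proof.
have /asboolP[fl _] := rconj_funP f.
by have := fl 1 x y; rewrite -[L0_cst P 1]/(1 : L0C P) scale1r mul1r.
Qed.

Lemma rconj0 f : f 0 = 0.
Proof. by apply: (addrI (f 0)); rewrite -rconjD !addr0. Qed.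

Lemma rconjN f x : f (- x) = - f x.
Proof. by apply: (addrI (f x)); rewrite -rconjD !subrr rconj0. Qed.

Lemma rconj_cstZ f (c : R[i]) x : f (L0_cst P c *: x) = L0_cst P c * f x.
Proof.
have /asboolP[fl _] := rconj_funP f.
by have := fl c x 0; rewrite rconj0 !addr0.
Qed.

(* Comparing [f (a *: x)] with [c * f x] for the countably many rational
   constants [c] turns boundedness into a pointwise continuity argument. *)
Lemma rconjZ f a x : f (a *: x) = a * f x.
Proof.
have [b b0 fb] := rconj_boundP f.
pose c (q : rat * rat) : R[i] := (ratr q.1 +i* ratr q.2)%C.
have H q : \forall w \ae P,
    normc ((f (a *: x) : L0C P) w - c q * (f x : L0C P) w) <=
    b w * (normc (a w - c q) * rnorm x w).
  (* Linearity over constants makes the difference equal to [f y], and boundedness of [f] estimates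
     it through the norm of [y]. *)
  pose y := (a - L0_cst P (c q)) *: x.
  have fy : f (a *: x) = L0_cst P (c q) * f x + f y.
    by rewrite -rconj_cstZ -rconjD -scalerDl addrC subrK.
  near=> w.
  have -> : (f (a *: x) : L0C P) w - c q * (f x : L0C P) w = (f y : L0C P) w.
    rewrite fy [X in X - _](near (L0C_add_ae _ _) w)//.
    rewrite (near (L0C_mul_ae _ _) w)// (near (L0_cst_ae P _) w)//.
    by rewrite addrC addKr.
  rewrite (le_trans (near (fb y) w _))//.
  rewrite (near (rnormZ_ae _ _) w)// (near (L0C_add_ae _ _) w)//.
  by rewrite (near (L0C_opp_ae _) w)// (near (L0_cst_ae P _) w).
apply/L0C_eqP; have {}H := ae_forall_countable H.
near=> w; have Hw : forall q, normc ((f (a *: x) : L0C P) w - c q * (f x : L0C P) w)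
  <= b w * (normc (a w - c q) * rnorm x w) by near: w.
rewrite [RHS](near (L0C_mul_ae _ _) w)//.
set F := (f (a *: x) : L0C P) w in Hw *; set G := (f x : L0C P) w in Hw *.
apply/eqP; rewrite -subr_eq0; apply/eqP/eq0_normc/eqP.
rewrite eq_le normc_ge0 andbT.
have Bx : 0 <= b w * rnorm x w.
  rewrite mulr_ge0//; first by near: w; exact: L0R_ge0_ae.
  by near: w; exact: rnorm_ge0_ae.
(* The factor 2 is the constant of [ratc_dense]; the two summands come from [f y] and from replacing
   [a w] by [c q] in front of [G]. *)
apply: (@le0_harmonic _ _ (2 * (b w * rnorm x w + normc G))) => m.
have [q qP] := ratc_dense (a w) m.
have -> : F - a w * G = (F - c q * G) - (a w - c q) * G by ring.
rewrite (le_trans (le_normcD _ _))// normcN normcM.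
rewrite (le_trans (lerD (Hw q) (lexx _)))//.
rewrite mulrCA -mulrDr mulrAC ler_wpM2r// addr_ge0// normc_ge0//.
Unshelve. all: by end_near. Qed.

End rconj_theory.

(** * The dual norm, and concatenation along almost sure covers *)

Section rconj_norm_theory.
Context d (T : measurableType d) (R : realType) (P : probability T R).
Context (E : rnModuleType P).
Implicit Types (x y : E) (f g : rconj E) (a : L0C P).

Lemma rnorm0 : rnorm (0 : E) = 0.
Proof. exact/rnorm_eq0. Qed.

Lemma L0R_le01 : (0 : L0R P) <= 1.
Proof.
by apply/L0R_leP; apply: filterS2 (L0R_0_ae P) (L0R_1_ae P) => w -> ->.
Qed.

Lemma L0_norm_le_ae (z : L0C P) (u : L0R P) :
  L0_norm z <= u <-> \forall w \ae P, normc (z w) <= u w.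
Proof.
split=> [/L0R_leP|] zu; [|apply/L0R_leP]; move: zu;
by apply: filterS2 (L0_norm_ae z) => w ->.
Qed.

(** Turns the order-theoretic supremum into pointwise data: an almost sure bound on the unit ball,
    and one sequence that approaches it outside a null set independent of [e]. Later facts on the
    dual norm rest on these two. *)
Lemma rconj_norm_sup f :
  (forall x, rnorm x <= 1 ->
     \forall w \ae P, normc ((f x : L0C P) w) <= rconj_norm f w) /\
  exists2 y : nat -> E, forall k, rnorm (y k) <= 1 &
    \forall w \ae P, forall e, 0 < e ->
      exists k, rconj_norm f w - e < normc ((f (y k) : L0C P) w).
Proof.
pose S : set (L0R P) := [set L0_norm (f y) | y in [set y : E | rnorm y <= 1]].
have S0 : S !=set0.
  by exists (L0_norm (f 0)), 0 => //=; rewrite rnorm0 L0R_le01.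
have [b b0 fb] := rconj_boundP f.
have Sb : ubound S b.
  move=> _ [y /= /L0R_leP y1 <-]; apply/L0_norm_le_ae.
  near=> w; rewrite (le_trans (near (fb y) w _))// ler_piMr//.
    by near: w; exact: L0R_ge0_ae.
  by rewrite -(near (L0R_1_ae P) w)//; near: w.
have [s [u [Ss uS su]]] := L0R_dedekind S0 Sb.
(* [supremum] selects some least upper bound, and it is unique; [u] is one because any upper bound
   dominates the approximating sequence [s]. *)
have -> : rconj_norm f = u.
  rewrite /rconj_norm -/S /supremum ifF; last by apply/negbTE/set0P.
  apply: xget_subset1; last exact: is_subset1_supremums.
  split=> //; suff uv (v : L0R P) : ubound S v -> u <= v by move=> v; exact: uv.
  move=> vS; apply/L0R_leP.
  have : \forall w \ae P, forall k, s k w <= v w.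
    by apply: ae_foralln => k; apply/L0R_leP/vS.
  apply: filterS2 su => w uw sw; apply/ler_addgt0Pr => e /uw[k uk].
  by rewrite -lerBlDr; apply/ltW/(lt_le_trans uk).
split=> [x x1|]; first by apply/L0_norm_le_ae/uS; exists x.
have /choice[y yP] : forall k, exists y : E, rnorm y <= 1 /\ L0_norm (f y) = s k.
  by move=> k; have [y y1 <-] := Ss k; exists y.
exists y => [k|]; first exact: (yP k).1.
near=> w => e e0.
have [k uk] : exists k, u w - e < s k w.
  by move: e e0; near: w.
exists k; apply: (lt_le_trans uk).
rewrite -(yP k).2 [leLHS](_ : _ = normc ((f (y k) : L0C P) w))//.
by move: k {uk}; near: w; apply: ae_foralln => k; exact: L0_norm_ae.
Unshelve. all: by end_near. Qed.

Lemma rconj_norm_ge0 f : \forall w \ae P, 0 <= rconj_norm f w.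
Proof.
have [/(_ 0) h _] := rconj_norm_sup f.
have := h; rewrite rnorm0 => /(_ L0R_le01); apply: filterS => w.
exact/le_trans/normc_ge0.
Qed.

Lemma rconj_norm0 : \forall w \ae P, rconj_norm (0 : rconj E) w <= 0.
Proof.
have [_ [y _]] := rconj_norm_sup 0; apply: filterS2 (L0C_0_ae P) => w w0 yw.
apply/ler_addgt0Pr => e /yw[k].
by rewrite [X in normc X]w0 normc0 subr_lt0 => /ltW; rewrite add0r.
Qed.

(** Scaling [x] by the pointwise inverse of its norm puts it in the unit ball. Where the norm
    vanishes the inverse says nothing, and the bound [b] of [f] gives [f x = 0] there. *)
Lemma rconj_le_norm f x :
  \forall w \ae P, normc ((f x : L0C P) w) <= rconj_norm f w * rnorm x w.
Proof.
have [r rE] := L0C_real_ex (rnorm x); have [a aE] := L0C_inv_ex r.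
have [b b0 fb] := rconj_boundP f.
have naE : \forall w \ae P, normc (a w) = (rnorm x w)^-1.
  near=> w; rewrite (near aE w)// (near rE w)// normcV normc_real ger0_norm//.
  by near: w; exact: rnorm_ge0_ae.
have ax1 : rnorm (a *: x) <= 1.
  apply/L0R_leP; near=> w.
  rewrite (near (rnormZ_ae _ _) w)// (near naE w)// (near (L0R_1_ae P) w)//.
  by have [->|x0] := eqVneq (rnorm x w) 0; rewrite ?mulr0// mulVf.
have [/(_ _ ax1) fax _] := rconj_norm_sup f.
near=> w.
have x0 : 0 <= rnorm x w by near: w; exact: rnorm_ge0_ae.
have [x00|xn0] := eqVneq (rnorm x w) 0.
  by rewrite (le_trans (near (fb x) w _))// x00 !mulr0.
have : normc ((f (a *: x) : L0C P) w) <= rconj_norm f w by near: w.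
rewrite rconjZ (near (L0C_mul_ae _ _) w)// normcM (near naE w)//.
by rewrite mulrC ler_pdivrMr// lt_def xn0.
Unshelve. all: by end_near. Qed.

(** Allows events that overlap and cover only almost everywhere, and records the outcome pointwise:
    at [w] the glued vector behaves like [x (kappa w)], both in norm and under every functional. *)
Lemma countable_concatenation_ae (cc : countable_concatenation E)
    (x : nat -> E) (B : nat -> set T) :
  (forall k, measurable (B k)) -> (\forall w \ae P, exists k, B k w) ->
  exists (y : E) (kappa : T -> nat), [/\
    \forall w \ae P, B (kappa w) w,
    \forall w \ae P, rnorm y w = rnorm (x (kappa w)) w &
    forall f, \forall w \ae P, (f y : L0C P) w = (f (x (kappa w)) : L0C P) w].
Proof.
move=> mB BT; pose B' k := B k `|` ~` \bigcup_k B k.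
have mB' k : measurable (B' k).
  by apply: measurableU => //; apply/measurableC/bigcupT_measurable.
have mA := seqDU_measurable mB'.
have AT : \bigcup_k seqDU B' k = setT.
  rewrite -seqDU_bigcup_eq; apply/seteqP; split=> // w _.
  have [[k _ Bk]|nB] := pselect ((\bigcup_k B k) w); first by exists k => //; left.
  by exists 0%N => //; right.
have [y yE] := cc x _ mA (@trivIset_seqDU _ B') AT.
have /choice[kappa kappaP] : forall w, exists k, seqDU B' k w.
  by move=> w; have : [set: T] w by []; rewrite -AT => -[k _ Ak]; exists k.
have indE : \forall w \ae P, L0_indic P (mA (kappa w)) w = 1.
  have : \forall w \ae P, forall k, L0_indic P (mA k) w = (\1_(seqDU B' k) w : R)%:C%C.
    by apply: ae_foralln => k; exact: L0_indic_ae.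
  by apply: filterS => w ->; rewrite indicE mem_set.
exists y, kappa; split.
- apply: filterS BT => w [k Bk].
  have [//|[]] : B' (kappa w) w := subset_seqDU (kappaP w).
  by exists k.
- have : \forall w \ae P, forall k,
      normc (L0_indic P (mA k) w) * rnorm y w =
      normc (L0_indic P (mA k) w) * rnorm (x k) w.
    apply: ae_foralln => k.
    have := rnormZ_ae (L0_indic P (mA k)) (x k); rewrite -yE.
    by apply: filterS2 (rnormZ_ae (L0_indic P (mA k)) y) => w ->.
  apply: filterS2 indE => w w1 /(_ (kappa w)).
  by rewrite w1 normc1 !mul1r.
- move=> f.
  have : \forall w \ae P, forall k,
      L0_indic P (mA k) w * (f y : L0C P) w =
      L0_indic P (mA k) w * (f (x k) : L0C P) w.
    apply: ae_foralln => k.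
    apply: filterS2 (L0C_mul_ae (L0_indic P (mA k)) (f y)) 
      (L0C_mul_ae (L0_indic P (mA k)) (f (x k))) => w <- <-.
    by rewrite -!rconjZ yE.
  by apply: filterS2 indE => w w1 /(_ (kappa w)); rewrite w1 !mul1r.
Qed.

End rconj_norm_theory.

(** * Finite expansion of the functionals *)

Section rconj_span.
Context d (T : measurableType d) (R : realType) (P : probability T R).
Context (E : rnModuleType P) (cc : countable_concatenation E).
Implicit Types (x y : E) (f g : rconj E) (a : L0C P).

Lemma rconj_sum f (I : Type) (r : seq I) (x : I -> E) :
  f (\sum_(i <- r) x i) = \sum_(i <- r) f (x i).
Proof. by elim/big_rec2: _ => [|i z y _ <-]; rewrite ?rconj0 ?rconjD. Qed.

Lemma rconj_sumE (I : Type) (r : seq I) (a : I -> L0C P) (f : I -> rconj E) x :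
  (\sum_(i <- r) a i *: f i : rconj E) x = \sum_(i <- r) a i * f i x.
Proof. by elim/big_rec2: _ => // i z y _ <-. Qed.

Lemma L0_norm_gt0 a : \forall w \ae P, (0 < L0_norm a w) = (a w != 0).
Proof.
apply: filterS (L0_norm_ae a) => w ->; rewrite lt_def normc_ge0 andbT.
by apply/idP/idP; apply: contra => /eqP; [move->; rewrite normc0|move/eq0_normc->].
Qed.

(* [e] is normalized so that [g e] is the indicator of the support of [g]. *)
Lemma rconj_support g : exists e : E, forall x, g x = g x * g e.
Proof.
have [_ [y _ yg]] := rconj_norm_sup g.
(* Where the dual norm of [g] is positive, the approximating sequence taken with error equal to that
   norm yields some [y k] with [g (y k)] nonzero; elsewhere any index will do. *)
pose B k := [set w | 0 < L0_norm (g (y k)) w] `|` ~` [set w | 0 < rconj_norm g w].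
have mB k : measurable (B k).
  by apply: measurableU; [|apply: measurableC]; exact: measurable_L0R_gt.
have [|z [kappa [Bz _ gz]]] := countable_concatenation_ae cc y mB.
  have : \forall w \ae P, forall k,
      L0_norm (g (y k)) w = normc ((g (y k) : L0C P) w).
    by apply: ae_foralln => k; exact: L0_norm_ae.
  apply: filterS2 yg => w yw nE.
  have [h0|h0] := pselect (0 < rconj_norm g w); last by exists 0%N; right.
  by have [k] := yw _ h0; rewrite subrr -nE; exists k; left.
(* Where [g z] is nonzero, [g (a *: z)] equals 1; where it vanishes, so does the dual norm of [g],
   and both sides are 0. *)
have [a aE] := L0C_inv_ex (g z); exists (a *: z) => x; apply/L0C_eqP.
have gyn : \forall w \ae P, forall k,
    (0 < L0_norm (g (y k)) w) = ((g (y k) : L0C P) w != 0).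
  by apply: ae_foralln => k; exact: L0_norm_gt0.
near=> w.
rewrite rconjZ [RHS](near (L0C_mul_ae _ _) w)// (near (L0C_mul_ae _ _) w)//.
rewrite (near aE w)//.
have [gz0|gz0] := eqVneq ((g z : L0C P) w) 0; last by rewrite mulVf// mulr1.
have : B (kappa w) w by near: w.
rewrite /B/=; have -> : (0 < L0_norm (g (y (kappa w))) w) = ((g z : L0C P) w != 0).
  by rewrite (near (gz g) w)//; move: (kappa w); near: w.
rewrite gz0 eqxx => -[//|/negP]; rewrite -leNgt => h0.
rewrite [LHS](_ : _ = 0) ?mulr0 ?mul0r//; apply: eq0_normc.
apply/eqP; rewrite eq_le normc_ge0 andbT (le_trans (near (rconj_le_norm g x) w _))//.
by rewrite mulr_le0_ge0//; near: w; exact: rnorm_ge0_ae.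
Unshelve. all: by end_near. Qed.

(* Gram-Schmidt elimination: [g] is the part of [f0] that vanishes on the
   vectors already chosen, and [e'] is corrected so as to be killed by [l]. *)
Lemma rconj_expansion (V : set (rconj E)) (l : seq (rconj E)) :
  (forall a g h, V g -> V h -> V (a *: g + h)) -> (forall f, f \in l -> V f) ->
  exists2 s : seq (rconj E * E), forall p, p \in s -> V p.1 &
    forall f, f \in l -> forall x, f x = \sum_(p <- s) p.1 x * f p.2.
Proof.
move=> VD; elim: l => [|f0 l IH] Vl; first by exists [::].
have [f lf|s Vs fs] := IH; first by apply: Vl; rewrite inE lf orbT.
pose g := f0 - \sum_(p <- s) (f0 p.2 : L0C P) *: p.1.
have gE x : g x = f0 x - \sum_(p <- s) p.1 x * f0 p.2.
  rewrite [LHS](_ : _ = f0 x - (\sum_(p <- s) (f0 p.2 : L0C P) *: p.1 : rconj E) x)//.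
  rewrite rconj_sumE; congr (_ - _); apply: eq_bigr => p _.
  by rewrite mulrC.
have [e eP] := rconj_support g.
pose e' := e - \sum_(p <- s) (p.1 e : L0C P) *: p.2.
have fe' f : f e' = f e - \sum_(p <- s) p.1 e * f p.2.
  rewrite rconjD rconjN rconj_sum; congr (_ - _).
  by apply: eq_bigr => p _; rewrite rconjZ.
have Vg : V g.
  rewrite /g big_seq; elim/big_rec: _ => [|p h ps Vh].
    by rewrite subr0; apply: Vl; rewrite mem_head.
  by rewrite opprD addrCA -scaleNr; apply: VD => //; exact: Vs.
exists ((g, e') :: s) => [p|f].
  by rewrite inE => /predU1P[->//|]; exact: Vs.
(* For [f0], the value [f0 e'] is [g e], and [g x * g e = g x] restores [f0 x]; for [f] in [l] the
   new term contains [f e' = 0]. *)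
rewrite inE => /predU1P[->|lf] x; rewrite big_cons/= fe'.
  by rewrite -gE -eP gE subrK.
by rewrite -(fs _ lf) subrr mulr0 add0r -fs.
Qed.

End rconj_span.

(** * Essential minimization of the residual over the ball *)

Section residual.
Context d (T : measurableType d) (R : realType) (P : probability T R).
Context (E : rnModuleType P) (cc : countable_concatenation E).
Context (n : nat) (f : 'I_n -> rconj E) (xi : 'I_n -> L0C P).
Context (beta : L0R P) (beta_ge0 : 0 <= beta).
Implicit Types (x y : E) (w : T).

Let beta0 : \forall w \ae P, 0 <= beta w.
Proof. exact: L0R_ge0_ae. Qed.

Definition residual x : L0R P :=
  \sum_k L0_norm (xi k - f k x) * L0_norm (xi k - f k x).

Lemma residual_ae x : \forall w \ae P,
  residual x w = \sum_k normc (xi k w - (f k x : L0C P) w) ^+ 2.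
Proof.
have H : \forall w \ae P, forall k,
    (L0_norm (xi k - f k x) * L0_norm (xi k - f k x) : L0R P) w
    = normc (xi k w - (f k x : L0C P) w) ^+ 2.
  apply: ae_forall_fin => k.
  near=> w; rewrite (near (L0R_mul_ae _ _) w)// (near (L0_norm_ae _) w)//.
  by rewrite (near (L0C_sub_ae _ _) w)// expr2.
apply: filterS2 H (L0R_sum_ae (index_enum 'I_n)
  (fun k => L0_norm (xi k - f k x) * L0_norm (xi k - f k x))) => w H ->.
by apply: eq_bigr => k _; exact: H.
Unshelve. all: by end_near. Qed.

Lemma residual_ge0 x : \forall w \ae P, 0 <= residual x w.
Proof.
by apply: filterS (residual_ae x) => w ->; apply: sumr_ge0 => k _; exact: sqr_ge0.
Qed.

(** Dedekind completeness gives the infimum together with a sequence approaching it pointwise;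
    concatenation merges that sequence into a single near-minimizer in the ball. *)
Lemma residual_inf : exists delta : L0R P,
  (forall x, rnorm x <= beta -> \forall w \ae P, delta w <= residual x w) /\
  forall eta : L0R P, L0R_pos eta -> exists2 x, rnorm x <= beta &
    \forall w \ae P, residual x w <= delta w + eta w.
Proof.
pose S : set (L0R P) := [set - residual x | x in [set x | rnorm x <= beta]].
have S0 : S !=set0 by exists (- residual 0), 0 => //=; rewrite rnorm0.
have Sb : ubound S 0.
  move=> _ [x /= _ <-]; apply/L0R_leP; near=> w.
  rewrite (near (L0R_opp_ae _) w)// (near (L0R_0_ae P) w)// oppr_le0.
  by near: w; exact: residual_ge0.
have [s [u [Ss uS su]]] := L0R_dedekind S0 Sb.
exists (- u); split=> [x xb|eta eta0].
  have /L0R_leP : - residual x <= u by apply: uS; exists x.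
  apply: filterS3 (L0R_opp_ae u) (L0R_opp_ae (residual x)) => w -> ->.
  by rewrite lerNl.
have /choice[x xP] : forall k, exists x, rnorm x <= beta /\ - residual x = s k.
  by move=> k; have [x xb <-] := Ss k; exists x.
(* With [delta = - u], this is the event that [x k] has residual below [delta + eta]; strict
   positivity of [eta] almost everywhere makes these events cover. *)
pose B k := [set w | 0 < (s k - u + eta : L0R P) w].
have BE : \forall w \ae P, forall k, (s k - u + eta : L0R P) w = s k w - u w + eta w.
  apply: ae_foralln => k; near=> w.
  by rewrite !(near (L0R_add_ae _ _) w)// (near (L0R_opp_ae _) w).
have [||y [kappa [By ny fy]]] := countable_concatenation_ae cc x (B := B).
- by move=> k; exact: measurable_L0R_gt.
- apply: filterS3 su BE eta0 => w suw BEw eta0w.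
  by have [k uk] := suw _ eta0w; exists k; rewrite /B/= BEw; lra.
exists y.
  apply/L0R_leP.
  have : \forall w \ae P, forall k, rnorm (x k) w <= beta w.
    by apply: ae_foralln => k; apply/L0R_leP; exact: (xP k).1.
  by apply: filterS2 ny => w -> /(_ (kappa w)).
have sE : \forall w \ae P, forall k, s k w = - residual (x k) w.
  by apply: ae_foralln => k; rewrite -(xP k).2; exact: L0R_opp_ae.
have rE : \forall w \ae P, forall k, residual (x k) w =
    \sum_j normc (xi j w - (f j (x k) : L0C P) w) ^+ 2.
  by apply: ae_foralln => k; exact: residual_ae.
have fyE : \forall w \ae P, forall j,
    (f j y : L0C P) w = (f j (x (kappa w)) : L0C P) w.
  by apply: ae_forall_fin => j; exact: fy.
near=> w.
have -> : residual y w = residual (x (kappa w)) w.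
  rewrite (near (residual_ae y) w)// (near rE w)//; apply: eq_bigr => j _.
  by congr (normc (_ - _) ^+ 2); move: j; near: w.
have : B (kappa w) w by near: w.
rewrite /B/= (near BE w)// (near sE w)// (near (L0R_opp_ae _) w)//.
by lra.
Unshelve. all: by end_near. Qed.

End residual.

(** * From the norm inequality to approximate solutions *)

Section duality.
Context d (T : measurableType d) (R : realType) (P : probability T R).

(** The witness is [conjc z] divided by the modulus of [z]; it is 0 where [z] vanishes, hence an
    inequality for its modulus. *)
Lemma L0C_phase (z : L0C P) : exists u : L0C P, \forall w \ae P,
  normc (u w) <= 1 /\ u w * z w = (normc (z w))%:C%C.
Proof.
have [c cE] := L0C_conj_ex z; have [r rE] := L0C_real_ex (L0_norm z).
have [a aE] := L0C_inv_ex r; exists (c * a); near=> w.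
rewrite (near (L0C_mul_ae _ _) w)// (near aE w)// (near rE w)// (near cE w)//.
rewrite (near (L0_norm_ae _) w)// normcM normcV normc_conj normc_real.
rewrite ger0_norm ?normc_ge0// mulrAC conjcM_normc.
have [->|z0] := eqVneq (normc (z w)) 0; first by rewrite mul0r expr0n/= mul0r.
by rewrite divff// -fmorphV -rmorphM expr2 mulfK.
Unshelve. all: by end_near. Qed.

Context (E : rnModuleType P) (cc : countable_concatenation E).
Context (n : nat) (f : 'I_n -> rconj E) (xi : 'I_n -> L0C P).
Context (beta : L0R P) (beta_ge0 : 0 <= beta).
Implicit Types (x y : E) (w : T).

Let beta0 : \forall w \ae P, 0 <= beta w.
Proof. exact: L0R_ge0_ae. Qed.

Lemma almost_minimal_bound (delta : L0R P) (s : R) x (lam : 'I_n -> L0C P) y :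
  0 < s -> s <= 1 -> rnorm x <= beta ->
  (forall x, rnorm x <= beta -> \forall w \ae P, delta w <= residual f xi x w) ->
  (\forall w \ae P, residual f xi x w <= delta w + s ^+ 2) ->
  (forall k, \forall w \ae P, lam k w = conjc (xi k w - (f k x : L0C P) w)) ->
  rnorm y <= 1 ->
  let g := \sum_k lam k *: f k in
  \forall w \ae P, beta w * normc ((g y : L0C P) w) <=
    complex.Re ((g x : L0C P) w) +
    s * (1 + \sum_k (2 * rconj_norm (f k) w * beta w) ^+ 2) / 2.
Proof.
move=> s0 s1 xb delta_le res_le lamE y1 g.
have gE z : \forall w \ae P,
    (g z : L0C P) w = \sum_k lam k w * (f k z : L0C P) w.
  have H : \forall w \ae P, forall k,
      (lam k * f k z : L0C P) w = lam k w * (f k z : L0C P) w.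
    by apply: ae_forall_fin => k; exact: L0C_mul_ae.
  rewrite /g rconj_sumE.
  apply: filterS2 H (L0C_sum_ae (index_enum 'I_n) (fun k => lam k * f k z)).
  by move=> w H ->; apply: eq_bigr => k _; exact: H.
have [b bE] := L0C_real_ex beta; have [u uE] := L0C_phase (g y).
have [z zb gz] : exists2 z : E, \forall w \ae P, rnorm z w <= beta w &
    \forall w \ae P, (g z : L0C P) w = (beta w * normc ((g y : L0C P) w))%:C%C.
  (* Rotating by the phase of [g y] and stretching by [beta] keeps the vector in the ball and makes
     the value of [g] real and nonnegative. *)
  exists ((b * u) *: y); near=> w.
    rewrite (near (rnormZ_ae _ _) w)// (near (L0C_mul_ae _ _) w)//.
    have b0 : 0 <= beta w by near: w.
    rewrite normcM (near bE w)// normc_real ger0_norm// -mulrA ler_piMr//.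
    rewrite mulr_ile1 ?normc_ge0//; first by near: w; exact: rnorm_ge0_ae.
      by have [] : normc (u w) <= 1 /\ u w * (g y : L0C P) w =
        (normc ((g y : L0C P) w))%:C%C by near: w.
    rewrite -(near (L0R_1_ae P) w)//; near: w; exact/L0R_leP.
  rewrite rconjZ (near (L0C_mul_ae _ _) w)// (near (L0C_mul_ae _ _) w)//.
  rewrite -mulrA; have [_ ->] : normc (u w) <= 1 /\ u w * (g y : L0C P) w =
      (normc ((g y : L0C P) w))%:C%C by near: w.
  by rewrite (near bE w)// -rmorphM.
have {}xb : \forall w \ae P, rnorm x w <= beta w by exact/L0R_leP.
(* The competitor is a convex combination because [s <= 1], so it stays in the ball; its error
   vector is that of [x] minus [s] times the values at [z - x]. *)
pose z' := L0_cst P (s%:C)%C *: z + L0_cst P ((1 - s)%:C)%C *: x.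
have z'b : rnorm z' <= beta.
  apply/L0R_leP; near=> w; rewrite (le_trans (near (rnormD_ae _ _) w _))//.
  rewrite !(near (rnormZ_ae _ _) w)// !(near (L0_cst_ae P _) w)// !normc_real.
  rewrite !ger0_norm ?subr_ge0 ?(ltW s0)//.
  rewrite [leRHS](_ : _ = s * beta w + (1 - s) * beta w); last by ring.
  by rewrite lerD// ler_wpM2l ?subr_ge0 ?(ltW s0)//; near: w.
have fz' : \forall w \ae P, forall k,
    (f k z' : L0C P) w = s%:C%C * (f k z : L0C P) w + (1 - s)%:C%C * (f k x : L0C P) w.
  apply: ae_forall_fin => k; near=> w.
  rewrite rconjD !rconjZ (near (L0C_add_ae _ _) w)// !(near (L0C_mul_ae _ _) w)//.
  by rewrite !(near (L0_cst_ae P _) w).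
have fb v : (\forall w \ae P, rnorm v w <= beta w) -> \forall w \ae P, forall k,
    normc ((f k v : L0C P) w) <= rconj_norm (f k) w * beta w.
  move=> vb; apply: ae_forall_fin => k; near=> w.
  rewrite (le_trans (near (rconj_le_norm _ _) w _))// ler_wpM2l//.
    by near: w; exact: rconj_norm_ge0.
  by near: w.
have {}lamE : \forall w \ae P, forall k,
  lam k w = conjc (xi k w - (f k x : L0C P) w) by exact: ae_forall_fin.
have h0 : \forall w \ae P, forall k, 0 <= rconj_norm (f k) w.
  by apply: ae_forall_fin => k; exact: rconj_norm_ge0.
near=> w.
rewrite -lerBlDl.
have -> : beta w * normc ((g y : L0C P) w) - complex.Re ((g x : L0C P) w) =
    complex.Re (\sum_k conjc (xi k w - (f k x : L0C P) w) *
                  ((f k z : L0C P) w - (f k x : L0C P) w)).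
  have -> : beta w * normc ((g y : L0C P) w) = complex.Re ((g z : L0C P) w).
    by rewrite (near gz w).
  have lamw : forall k, lam k w = conjc (xi k w - (f k x : L0C P) w) by near: w.
  rewrite !(near (gE _) w)// !Re_sum -sumrB; apply: eq_bigr => k _.
  rewrite mulrBr -lamw; case: (_ * _) => ? ?.
  by case: (_ * _) => ? ?.
apply: (Re_le_of_almost_minimal (delta := delta w)) => //.
- apply: (le_trans (near (delta_le _ z'b) w _)) => //.
  rewrite (near (residual_ae _ _ _) w)// le_eqVlt; apply/predU1P; left.
  have fz'w : forall k, (f k z' : L0C P) w =
    s%:C%C * (f k z : L0C P) w + (1 - s)%:C%C * (f k x : L0C P) w by near: w.
  apply: eq_bigr => k _; rewrite fz'w rmorphB rmorph1; congr (normc _ ^+ 2).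
  by ring.
- by rewrite -(near (residual_ae _ _ _) w)//; near: w.
(* Both [z] and [x] lie in the ball, so the difference of their values is at most twice the bound
   [fb]; hence the factor 2. *)
- apply: ler_sum => k _; rewrite ler_pXn2r// ?nnegrE ?normc_ge0//; last first.
    rewrite !mulr_ge0//; last by near: w.
    by move: k; near: w.
  rewrite (le_trans (le_normcD _ _))// normcN.
  have fzw : forall k, normc ((f k z : L0C P) w) <= rconj_norm (f k) w * beta w.
    by near: w; exact: fb.
  have fxw : forall k, normc ((f k x : L0C P) w) <= rconj_norm (f k) w * beta w.
    by near: w; exact: fb.
  by have := fzw k; have := fxw k; lra.
Unshelve. all: by end_near. Qed.

Lemma rconj_approx_solution (eta : L0R P) :
  (forall lam : 'I_n -> L0C P, L0_norm (\sum_k lam k * xi k)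
     <= beta * rconj_norm (\sum_k lam k *: f k)) ->
  L0R_pos eta ->
  exists2 x, rnorm x <= beta & \forall w \ae P, residual f xi x w <= eta w.
Proof.
move=> xi_le.
have [delta [delta_le delta_inf]] := residual_inf cc f xi beta_ge0.
suff delta0 : \forall w \ae P, delta w <= 0.
  move=> /delta_inf[x xb xd]; exists x => //.
  by apply: filterS2 delta0 xd => w d0; move/le_trans; apply; rewrite gerDr.
pose D w : R := \sum_k (2 * rconj_norm (f k) w * beta w) ^+ 2.
suff : \forall w \ae P, forall m, delta w <= (1 + D w) / 2 / m.+1%:R.
  by apply: filterS => w; exact: le0_harmonic.
apply: ae_foralln => m; pose s : R := m.+1%:R^-1.
have s0 : 0 < s by rewrite invr_gt0 ltr0n.
have s1 : s <= 1 by rewrite invf_le1 ?ltr0n// ler1n.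
have [sq sq0 sqE] := @L0R_pos_cst _ _ _ P (s ^+ 2) (exprn_gt0 2 s0).
have [x xb xd] := delta_inf sq sq0.
have {}xd : \forall w \ae P, residual f xi x w <= delta w + s ^+ 2.
  by apply: filterS2 xd sqE => w + <-.
have /choice[lam lamE] : forall k, exists lam : L0C P,
    \forall w \ae P, lam w = conjc (xi k w - (f k x : L0C P) w).
  move=> k; have [lam lamE] := L0C_conj_ex (xi k - f k x); exists lam.
  by apply: filterS2 lamE (L0C_sub_ae (xi k) (f k x)) => w -> ->.
pose g := \sum_k lam k *: f k.
have [_ [y y1 yg]] := rconj_norm_sup g.
have gy : \forall w \ae P, forall j, beta w * normc ((g (y j) : L0C P) w) <=
    complex.Re ((g x : L0C P) w) + s * (1 + D w) / 2.
  by apply: ae_foralln => j; exact: (almost_minimal_bound s0 s1 xb delta_le xd lamE (y1 j)).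
have bg : \forall w \ae P, beta w * rconj_norm g w <=
    complex.Re ((g x : L0C P) w) + s * (1 + D w) / 2.
  apply: filterS3 beta0 yg gy => w b0 yw gyw; apply/ler_addgt0Pr => e e0.
  have b1 : 0 < beta w + 1 by rewrite ltr_wpDl.
  (* Dividing by [beta w + 1] keeps the loss [beta w * (e / (beta w + 1))] below [e], also where
     [beta] vanishes. *)
  have [j jP] := yw (e / (beta w + 1)) (divr_gt0 e0 b1).
  have := gyw j; have : beta w * (e / (beta w + 1)) <= e.
    by rewrite mulrCA ler_piMr ?(ltW e0)// ler_pdivrMr// mul1r lerDl.
  have : beta w * (rconj_norm g w - e / (beta w + 1)) <=
    beta w * normc ((g (y j) : L0C P) w) by rewrite ler_wpM2l// ltW.
  rewrite mulrBr; lra.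
have /L0_norm_le_ae xil := xi_le lam.
(* Splitting [xi] as value plus error isolates the residual: the last sum is the sum of the squared
   moduli of the errors. *)
have sumE : \forall w \ae P, (\sum_k lam k * xi k : L0C P) w =
    (g x : L0C P) w + \sum_k conjc (xi k w - (f k x : L0C P) w) *
      (xi k w - (f k x : L0C P) w).
  have H : \forall w \ae P, forall k, [/\
      (lam k * xi k : L0C P) w = lam k w * xi k w,
      (lam k * f k x : L0C P) w = lam k w * (f k x : L0C P) w &
      lam k w = conjc (xi k w - (f k x : L0C P) w)].
    apply: ae_forall_fin => k.
    by apply: filterS3 (L0C_mul_ae (lam k) (xi k)) (L0C_mul_ae (lam k) (f k x))
      (lamE k) => w.
  rewrite /g rconj_sumE; near=> w; rewrite !(near (L0C_sum_ae _ _) w)//.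
  rewrite -big_split/=; apply: eq_bigr => k _.
  have [-> -> <-] : [/\
      (lam k * xi k : L0C P) w = lam k w * xi k w,
      (lam k * f k x : L0C P) w = lam k w * (f k x : L0C P) w &
      lam k w = conjc (xi k w - (f k x : L0C P) w)] by move: k; near: w.
  by rewrite mulrBr addrC subrK.
near=> w.
have : normc ((\sum_k lam k * xi k : L0C P) w) <= beta w * rconj_norm g w.
  by rewrite -(near (L0R_mul_ae _ _) w)//; near: w.
move/(le_trans (Re_le_normc _)); rewrite (near sumE w)// ReD Re_sum.
under eq_bigr do rewrite Re_conjcM.
rewrite -(near (residual_ae _ _ _) w)// => h1.
have h2 := near (delta_le _ xb) w.
have h3 : beta w * rconj_norm g w <=
    complex.Re ((g x : L0C P) w) + s * (1 + D w) / 2 by near: w.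
have := h2 _; rewrite -/s => {}h2.
have -> : (1 + D w) / 2 * s = s * (1 + D w) / 2 by ring.
rewrite -(lerD2l (complex.Re ((g x : L0C P) w))); apply: le_trans h3.
by apply: le_trans h1; rewrite lerD2l h2.
Unshelve. all: by end_near. Qed.

End duality.

(** * Exact correction of a small error *)

Section exact_solution.
Context d (T : measurableType d) (R : realType) (P : probability T R).

(** The witness is [eps / (1 + M)], the added 1 guarding against zeros of [M]. *)
Lemma L0R_pos_mul_le (eps M : L0R P) : L0R_pos eps -> 0 <= M ->
  exists2 eta : L0R P, L0R_pos eta & \forall w \ae P, eta w * M w <= eps w.
Proof.
move=> eps0 /L0R_ge0_ae M0.
have [r rE] := L0C_real_ex (1 + M); have [a aE] := L0C_inv_ex r.
have E : \forall w \ae P, (eps * L0_norm a : L0R P) w = eps w / (1 + M w).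
  near=> w; rewrite (near (L0R_mul_ae _ _) w)// (near (L0_norm_ae _) w)//.
  rewrite (near aE w)// (near rE w)// normcV normc_real.
  rewrite (near (L0R_add_ae _ _) w)// (near (L0R_1_ae P) w)// ger0_norm//.
  by rewrite addr_ge0//; near: w.
exists (eps * L0_norm a).
  by apply: filterS3 eps0 M0 E => w e0 M0 ->; rewrite divr_gt0// ltr_pwDl.
apply: filterS3 eps0 M0 E => w e0 M0 ->.
rewrite mulrAC ler_pdivrMr; last by rewrite ltr_pwDl.
by rewrite ler_wpM2l ?(ltW e0)// lerDr.
Unshelve. all: by end_near. Qed.

Context (E : rnModuleType P).

Lemma rnorm_lincomb_ae (I : Type) (r : seq I) (a : I -> L0C P) (v : I -> E)
    (B : I -> L0R P) (eta : L0R P) :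
  (forall i, \forall w \ae P, normc (a i w) <= eta w * B i w) ->
  \forall w \ae P, rnorm (\sum_(i <- r) a i *: v i) w <=
    eta w * (\sum_(i <- r) B i * rnorm (v i) : L0R P) w.
Proof.
move=> aB; elim: r => [|i r IH].
  by near=> w; rewrite !big_nil rnorm0 (near (L0R_0_ae P) w)// mulr0.
near=> w; rewrite !big_cons (le_trans (near (rnormD_ae _ _) w _))//.
rewrite (near (L0R_add_ae _ _) w)// (near (L0R_mul_ae _ _) w)//.
rewrite (near (rnormZ_ae _ _) w)// mulrDr lerD//; last by near: w.
rewrite mulrA ler_wpM2r//; first by near: w; exact: rnorm_ge0_ae.
by near: w; exact: aB.
Unshelve. all: by end_near. Qed.

Context (cc : countable_concatenation E) (n : nat).
Context (f : 'I_n -> rconj E) (xi : 'I_n -> L0C P).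

(* The coefficients of the correction are the values that the functionals
   [p.1], which are combinations of the [f k], would take at the residual. *)
Lemma exact_correction :
  (forall lam : 'I_n -> L0C P,
     \sum_k lam k *: f k = 0 -> \sum_k lam k * xi k = 0) ->
  exists2 M : L0R P, 0 <= M & forall x (eta : L0R P),
    (forall k, \forall w \ae P, normc (xi k w - (f k x : L0C P) w) <= eta w) ->
    exists2 y, forall i, f i y = xi i &
      \forall w \ae P, rnorm y w <= rnorm x w + eta w * M w.
Proof.
move=> xi0.
pose V : set (rconj E) := [set g | exists lam : 'I_n -> L0C P, g = \sum_k lam k *: f k].
have [|g|s Vs fs] := rconj_expansion cc (V := V) (l := codom f).
- move=> a _ _ [lam ->] [mu ->]; exists (fun k => a * lam k + mu k).
  rewrite scaler_sumr -big_split/=; apply: eq_bigr => k _.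
  by rewrite scalerDl scalerA.
- move=> /codomP[i ->]; exists (fun k => (k == i)%:R).
  rewrite (bigD1 i)//= eqxx scale1r big1 ?addr0// => k /negbTE ->.
  by rewrite scale0r.
have /choice[lam lamE] : forall g, exists lam : 'I_n -> L0C P,
    V g -> g = \sum_k lam k *: f k.
  move=> g; have [[lam ->]|nV] := pselect (V g); first by exists lam.
  by exists (fun=> 0) => /nV.
pose c (z : 'I_n -> L0C P) g : L0C P := \sum_k lam g k * z k.
have cE x p : p \in s -> p.1 x = c (fun k => f k x) p.1.
  by move=> /Vs/lamE {1}->; exact: rconj_sumE.
(* Coefficients, in terms of the [f k], of [f i] minus its expansion along [s]. This difference is
   zero, so [mu i] is a linear relation among the [f k], and [xi0] transfers it to [xi]. *)
pose mu i k : L0C P := (k == i)%:R - \sum_(p <- s) lam p.1 k * f i p.2.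
have muE i z : \sum_k mu i k * z k = z i - \sum_(p <- s) c z p.1 * f i p.2.
  under eq_bigr do rewrite mulrBl; rewrite sumrB; congr (_ - _).
    rewrite (bigD1 i)//= eqxx mul1r big1 ?addr0// => k /negbTE ->.
    by rewrite mul0r.
  under eq_bigr do rewrite mulr_suml.
  rewrite exchange_big/=; apply: eq_bigr => p _; rewrite mulr_suml.
  by apply: eq_bigr => k _; rewrite mulrAC.
have muf i x : \sum_k mu i k * f k x = 0.
  rewrite (muE i (fun k => f k x)) [X in X - _](fs _ (codom_f f i)).
  apply/eqP; rewrite subr_eq0; apply/eqP; rewrite !big_seq.
  by apply: eq_bigr => p ps; rewrite cE.
have muxi i : \sum_k mu i k * xi k = 0.
  by apply: xi0; apply: val_inj; apply/funext => x; rewrite [LHS]rconj_sumE muf.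
pose B g : L0R P := \sum_k L0_norm (lam g k).
have BE g : \forall w \ae P, B g w = \sum_k normc (lam g k w).
  have H : \forall w \ae P, forall k, L0_norm (lam g k) w = normc (lam g k w).
    by apply: ae_forall_fin => k; exact: L0_norm_ae.
  apply: filterS2 H (L0R_sum_ae (index_enum 'I_n) (fun k => L0_norm (lam g k))).
  by move=> w H ->; apply: eq_bigr.
(* [M] is fixed before [x] and [eta], so that [eta] may later be chosen small relative to [M]. *)
exists (\sum_(p <- s) B p.1 * rnorm p.2).
  elim/big_rec: _ => // p M _ /L0R_ge0_ae M0; apply/L0R_leP; near=> w.
  rewrite (near (L0R_0_ae P) w)// (near (L0R_add_ae _ _) w)//.
  rewrite (near (L0R_mul_ae _ _) w)// addr_ge0//; last by near: w.
  rewrite mulr_ge0//; last by near: w; exact: rnorm_ge0_ae.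
  by rewrite (near (BE _) w)// sumr_ge0// => k _; exact: normc_ge0.
move=> x eta xeta.
pose a (p : rconj E * E) : L0C P := c (fun k => xi k - f k x) p.1.
exists (x + \sum_(p <- s) a p *: p.2) => [i|].
  rewrite rconjD rconj_sum; under eq_bigr do rewrite rconjZ.
  (* The error [xi - f x] satisfies every relation [mu i], so its expansion along [s] is exact and
     the correction contributes precisely [xi i - f i x]. *)
  have /= := muE i (fun k => xi k - f k x).
  under eq_bigr do rewrite mulrBr; rewrite sumrB muf muxi subr0.
  by move/esym/eqP; rewrite subr_eq0 => /eqP <-; rewrite addrC subrK.
have aB p : \forall w \ae P, normc (a p w) <= eta w * B p.1 w.
  have H : \forall w \ae P, forall k,
      normc ((lam p.1 k * (xi k - f k x) : L0C P) w) <= eta w * normc (lam p.1 k w).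
    apply: ae_forall_fin => k; near=> w.
    rewrite (near (L0C_mul_ae _ _) w)// normcM mulrC ler_wpM2r ?normc_ge0//.
    by rewrite (near (L0C_sub_ae _ _) w)//; near: w; exact: xeta.
  near=> w; rewrite (near (BE _) w)// (near (L0C_sum_ae _ _) w)//.
  rewrite (le_trans (normc_sum _ _))// mulr_sumr ler_sum// => k _.
  by move: k; near: w.
near=> w; rewrite (le_trans (near (rnormD_ae _ _) w _))// lerD2l.
by near: w; exact: rnorm_lincomb_ae.
Unshelve. all: by end_near. Qed.

End exact_solution.

(** * Equivalence of norm-controlled interpolation and the duality inequality *)

Theorem theorem3p2 (d : measure_display) (T : measurableType d) (R : realType)
    (P : probability T R) (E : rnModuleType P)
    (cc : countable_concatenation E)
    (n : nat) (n_gt0 : (0 < n)%N) (f : 'I_n -> rconj E) (xi : 'I_n -> L0C P)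
    (beta : L0R P) (beta_ge0 : 0 <= beta) :
  (forall eps : L0R P, L0R_pos eps ->
     exists x : E, (forall i, f i x = xi i) /\ rnorm x <= beta + eps)
  <->
  (forall lam : 'I_n -> L0C P,
     L0_norm (\sum_(k < n) lam k * xi k)
       <= beta * rconj_norm (\sum_(k < n) lam k *: f k)).
Proof.
split=> [solve lam|xi_le eps eps0].
  set g := \sum_k lam k *: f k; apply/L0_norm_le_ae.
  (* The constant [eps = m.+1%:R^-1] costs at most the dual norm of [g] times [eps], which
     disappears as [m] grows. *)
  suff H m : \forall w \ae P,
      normc ((\sum_k lam k * xi k : L0C P) w) - beta w * rconj_norm g w <=
      rconj_norm g w / m.+1%:R.
    have {}H := ae_foralln H.
    apply: filterS2 (L0R_mul_ae beta (rconj_norm g)) H => w -> /le0_harmonic.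
    by rewrite subr_le0.
  have [|e e0 eE] := @L0R_pos_cst _ _ _ P m.+1%:R^-1.
    by rewrite invr_gt0 ltr0n.
  have [x [fx /L0R_leP xb]] := solve e e0.
  have -> : \sum_k lam k * xi k = g x.
    by rewrite /g rconj_sumE; apply: eq_bigr => k _; rewrite fx.
  near=> w; rewrite lerBlDl (le_trans (near (rconj_le_norm _ _) w _))//.
  rewrite [X in _ <= X + _]mulrC -mulrDr ler_wpM2l//.
    by near: w; exact: rconj_norm_ge0.
  by rewrite -(near eE w)// -(near (L0R_add_ae _ _) w)//; near: w.
(* Consistency of the system: if the combination of the [f k] is zero, its dual norm vanishes, and
   the hypothesis forces the same combination of the [xi k] to vanish. *)
have [|M M0 correct] := exact_correction cc (f := f) (xi := xi).
  move=> lam lam0; apply/L0C_eqP.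
  have /L0_norm_le_ae := xi_le lam; rewrite lam0 => h.
  near=> w; rewrite (near (L0C_0_ae P) w)//; apply: eq0_normc; apply/eqP.
  rewrite eq_le normc_ge0 andbT (le_trans (near h w _))//.
  rewrite (near (L0R_mul_ae _ _) w)// mulr_ge0_le0//.
    by near: w; exact: L0R_ge0_ae.
  by near: w; exact: rconj_norm0.
have [eta eta0 etaM] := L0R_pos_mul_le eps0 M0.
(* The residual is a sum of squares: the bound [eta * eta] keeps every component of the error below
   [eta], and the correction then costs at most [eta * M <= eps]. *)
have [|x xb xr] := rconj_approx_solution cc beta_ge0 (eta := eta * eta) xi_le.
  by apply: filterS2 eta0 (L0R_mul_ae eta eta) => w w0 ->; rewrite mulr_gt0.
have [k|y fy yx] := correct x eta.
  near=> w.
  have w0 : 0 <= eta w by apply: ltW; near: w.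
  rewrite -(@ler_pXn2r _ 2)// ?nnegrE ?normc_ge0//.
  have : residual f xi x w <= eta w ^+ 2.
    by rewrite expr2 -(near (L0R_mul_ae _ _) w)//; near: w.
  rewrite (near (residual_ae _ _ _) w)//; apply: le_trans.
  by rewrite (bigD1 k)//= lerDl sumr_ge0// => j _; exact: sqr_ge0.
exists y; split=> //; apply/L0R_leP; near=> w.
rewrite (le_trans (near yx w _))// (near (L0R_add_ae _ _) w)// lerD//.
  by near: w; exact/L0R_leP.
by near: w.
Unshelve. all: by end_near. Qed.
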